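(* There is an $\mathrm{REA}[\omega]$ set $C\subseteq\omega$ which is not computable and such that $C$ and $\emptyset'$ form a minimal pair: every set $X\subseteq\omega$ with $X\le_T C$ and $X\le_T \emptyset'$ is computable (i.e. $\deg(C)\wedge \mathbf{0}'=\mathbf{0}$).
   Context: Let $\langle x,y\rangle$ denote a standard computable pairing function. For $X\subseteq\omega$, the $n$-th column is $X^{[n]}=\{y:\langle n,y\rangle\in X\}$ and $X^{[<n]}=\{\langle m,y\rangle\in X: m<n\}$ (so $X^{[<0]}=\emptyset$). $W_e^Z$ denotes the $e$-th set computably enumerable relative to $Z$. A set $C\subseteq\omega$ is $\mathrm{REA}[\omega]$ iff there is a computable function $f$ such that for every $n$, $C^{[n]}=W^{C^{[<n]}}_{f(n)}$. $\emptyset'$ is the halting set. *)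

(* Defs.v *)
From HB Require Import structures.
From mathcomp Require Import all_boot.
From Stdlib Require Import ClassicalDescription.
Set Implicit Arguments. Unset Strict Implicit. Unset Printing Implicit Defensive.

(* Model of oracle computation: counter (Minsky) machines with an      *)
(* oracle-query instruction.  Sets of naturals are nat -> bool.        *)

Inductive instr : Type :=
| Inc of nat
| Dec of nat & nat
| Orc of nat.

Definition instr_code (i : instr) : nat * nat * nat :=
  match i with Inc r => (0, r, 0) | Dec r j => (1, r, j) | Orc r => (2, r, 0) end.
Definition instr_decode (c : nat * nat * nat) : option instr :=
  match c with
  | (0, r, _) => Some (Inc r) | (1, r, j) => Some (Dec r j)
  | (2, r, _) => Some (Orc r) | _ => None end.
Lemma instr_codeK : pcancel instr_code instr_decode.
Proof. by case. Qed.
HB.instance Definition _ := Countable.copy instr (pcan_type instr_codeK).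

Definition program := seq instr.

Definition prog_of (e : nat) : program := odflt [::] (unpickle e).

Definition regs := nat -> nat.
Definition upd (r : regs) (k v : nat) : regs := fun i => if i == k then v else r i.

Definition exec (X : nat -> bool) (i : instr) (pc : nat) (r : regs) : nat * regs :=
  match i with
  | Inc k => (pc.+1, upd r k (r k).+1)
  | Dec k j => if r k == 0 then (j, r) else (pc.+1, upd r k (r k).-1)
  | Orc k => (pc.+1, upd r k (nat_of_bool (X (r k))))
  end.

Fixpoint run (X : nat -> bool) (p : program) (fuel pc : nat) (r : regs) : option regs :=
  match fuel with
  | 0 => None
  | f.+1 => if pc < size p then
              let: (pc', r') := exec X (nth (Inc 0) p pc) pc r in run X p f pc' r'
            else Some r
  end.

Definition init (n : nat) : regs := fun i => if i == 0 then n else 0.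

Definition Phi (X : nat -> bool) (e n y : nat) : Prop :=
  exists s r, run X (prog_of e) s 0 (init n) = Some r /\ r 0 = y.

Definition W (X : nat -> bool) (e : nat) : nat -> Prop := fun n => exists y, Phi X e n y.

Definition empty_set : nat -> bool := fun _ => false.

Definition turing_le (X Y : nat -> bool) : Prop :=
  exists e, forall n, Phi Y e n (nat_of_bool (X n)).

Definition computable_set (X : nat -> bool) : Prop := turing_le X empty_set.

Definition computable_fun (f : nat -> nat) : Prop :=
  exists e, forall n, Phi empty_set e n (f n).

Definition halting_set : nat -> bool :=
  fun e => if excluded_middle_informative (W empty_set e e) then true else false.

(* Standard computable pairing bijection <x,y> = 2^x (2y+1) - 1, with first
   coordinate recovered as logn 2 (<x,y> + 1). *)
Definition pairing (x y : nat) : nat := 2 ^ x * (2 * y + 1) - 1.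
Definition pfst (z : nat) : nat := logn 2 z.+1.

Definition column (X : nat -> bool) (n : nat) : nat -> bool := fun y => X (pairing n y).
Definition below (X : nat -> bool) (n : nat) : nat -> bool := fun z => (pfst z < n) && X z.

Definition REA_omega (C : nat -> bool) : Prop :=
  exists f : nat -> nat, computable_fun f /\
    forall n y, column C n y <-> W (below C n) (f n) y.

(* Main.v *)
(* Strings are finite approximations to the set C being built.  Requirement n, a
   pair of functionals (a, b), owns three columns.  Column 3n is a counter: it fills
   up as long as no splitting is known, i.e. no two admissible strings giving
   different a-values at some x, or as long as the choice between the two strings
   (the one whose a-value differs from the current approximation to the b-value with
   oracle 0') keeps changing.  If the counter stops, column 3n+1 receives a marker:
   an element in position |u| followed by an element coding the chosen string u, and
   the later columns are then forced to agree with u below |u|.  Column 3n+2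
   diagonalises against the n-th machine at a position that is not restrained.

   The point is that every enumeration into a column beyond 3n+1 made at stage t
   presupposes that no marker of requirement n is below t.  Hence a string u can still
   be forced later as soon as it obeys the enumerations seen by its own initial
   segments, a decidable property of u.  If the counter runs forever then C is a limit
   of such strings; none of them splits, so they all give the right a-values and,
   C being computable on the first 3n columns, X is computable.  If it stops, then
   the a-value of C differs from X.  No permission from, or approximation to, the
   lower priority requirements is needed. *)
From Stdlib Require Import FunctionalExtensionality ClassicalDescription Classical.
Require Import Defs.
From mathcomp Require Import all_boot zify.
Set Implicit Arguments. Unset Strict Implicit. Unset Printing Implicit Defensive.

(** * Primitive recursive operators *)

Definition psnd (z : nat) : nat := (z.+1 %/ 2 ^ pfst z)./2.

Lemma pairingS x y : (pairing x y).+1 = 2 ^ x * (2 * y + 1).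
Proof. by rewrite /pairing subn1 prednK // muln_gt0 expn_gt0 addn1. Qed.

Lemma pfst_pairing x y : pfst (pairing x y) = x.
Proof.
rewrite /pfst pairingS lognM ?expn_gt0 ?addn1 // pfactorK //.
by rewrite logn_coprime ?addn0 // coprime2n /= oddM.
Qed.

Lemma psnd_pairing x y : psnd (pairing x y) = y.
Proof.
rewrite /psnd pfst_pairing pairingS mulKn ?expn_gt0 //.
by rewrite addn1 mul2n -[_./2]/(uphalf (y.*2)) uphalf_double.
Qed.

Lemma pairing_eta z : pairing (pfst z) (psnd z) = z.
Proof.
apply: succn_inj; rewrite pairingS.
have dv : 2 ^ pfst z %| z.+1 by apply: pfactor_dvdnn.
have -> : 2 * psnd z + 1 = z.+1 %/ 2 ^ pfst z.
  have od : odd (z.+1 %/ 2 ^ pfst z).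
    have := @pfactor_coprime 2 z.+1 isT isT => -[m]; rewrite coprime2n => om e.
    by rewrite {1}e mulnK ?expn_gt0.
  by rewrite /psnd -[RHS]odd_double_half od mul2n addnC.
by rewrite mulnC divnK.
Qed.

Lemma pairing0 y : pairing 0 y = y.*2.
Proof. by apply: succn_inj; rewrite pairingS mul1n mul2n addn1. Qed.

Lemma pairingSl x y : pairing x.+1 y = (pairing x y).*2.+1.
Proof. apply: succn_inj; rewrite -doubleS !pairingS expnS -mulnA; lia. Qed.

Lemma pfst_even z : odd z = false -> pfst z = 0 /\ psnd z = z./2.
Proof.
move=> oz; have -> : z = pairing 0 z./2 by rewrite pairing0 even_halfK ?oz.
by rewrite pfst_pairing psnd_pairing pairing0 doubleK.
Qed.

Lemma pfst_odd z : odd z -> pfst z = (pfst z./2).+1 /\ psnd z = psnd z./2.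
Proof.
move=> oz.
have -> : z = pairing (pfst z./2).+1 (psnd z./2).
  by rewrite pairingSl pairing_eta odd_halfK // prednK //; case: z oz.
by rewrite pfst_pairing psnd_pairing pairingSl /= uphalf_double pairing_eta.
Qed.

Lemma pairing_gel x y : x <= pairing x y.
Proof.
rewrite -ltnS pairingS; apply: (leq_trans (ltn_expl x (ltnSn 1))).
by rewrite leq_pmulr // addn1.
Qed.

Lemma pairing_ger x y : y.*2 <= pairing x y.
Proof.
elim: x => [|x IH]; first by rewrite pairing0.
by rewrite pairingSl; lia.
Qed.

Lemma pfst_le z : pfst z <= z.
Proof. by rewrite -{2}(pairing_eta z) pairing_gel. Qed.
Lemma psnd_le z : (psnd z).*2 <= z.
Proof. by rewrite -{2}(pairing_eta z) pairing_ger. Qed.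
Lemma psnd_leq z : psnd z <= z.
Proof. have := psnd_le z; lia. Qed.

(* Pairing replaces tuples of arguments, and iteration primitive recursion. *)
Inductive pr : ((nat -> bool) -> nat -> nat) -> Prop :=
| pr_ext F G : pr F -> (forall X x, F X x = G X x) -> pr G
| pr_id : pr (fun _ x => x)
| pr_zero : pr (fun _ _ => 0)
| pr_succ : pr (fun _ x => x.+1)
| pr_fst : pr (fun _ x => pfst x)
| pr_snd : pr (fun _ x => psnd x)
| pr_orc : pr (fun X x => X x)
| pr_comp F G : pr F -> pr G -> pr (fun X x => F X (G X x))
| pr_pair F G : pr F -> pr G -> pr (fun X x => pairing (F X x) (G X x))
| pr_iter F : pr F -> pr (fun X z => iter (pfst z) (F X) (psnd z)).

Definition pr1 (f : nat -> nat) := pr (fun _ x => f x).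
Definition pr2 (f : nat -> nat -> nat) := pr (fun _ x => f (pfst x) (psnd x)).
Definition pr3 (f : nat -> nat -> nat -> nat) :=
  pr (fun _ x => f (pfst x) (pfst (psnd x)) (psnd (psnd x))).
Definition pr4 (f : nat -> nat -> nat -> nat -> nat) :=
  pr (fun _ x => f (pfst x) (pfst (psnd x)) (pfst (psnd (psnd x)))
                   (psnd (psnd (psnd x)))).

Section Closure.
Implicit Types A B D E : (nat -> bool) -> nat -> nat.

Lemma pr_app1 f A : pr1 f -> pr A -> pr (fun X x => f (A X x)).
Proof. by move=> pf pA; apply: (pr_comp pf pA). Qed.

Lemma pr_app2 f A B : pr2 f -> pr A -> pr B -> pr (fun X x => f (A X x) (B X x)).
Proof.
move=> pf pA pB; apply: (pr_ext (pr_comp pf (pr_pair pA pB))) => X x.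
by rewrite pfst_pairing psnd_pairing.
Qed.

Lemma pr_app3 f A B D : pr3 f -> pr A -> pr B -> pr D ->
  pr (fun X x => f (A X x) (B X x) (D X x)).
Proof.
move=> pf pA pB pD; apply: (pr_ext (pr_comp pf (pr_pair pA (pr_pair pB pD)))) => X x.
by rewrite !(pfst_pairing, psnd_pairing).
Qed.

Lemma pr_app4 f A B D E : pr4 f -> pr A -> pr B -> pr D -> pr E ->
  pr (fun X x => f (A X x) (B X x) (D X x) (E X x)).
Proof.
move=> pf pA pB pD pE.
apply: (pr_ext (pr_comp pf (pr_pair pA (pr_pair pB (pr_pair pD pE))))) => X x.
by rewrite !(pfst_pairing, psnd_pairing).
Qed.

Lemma pr_const k : pr (fun _ _ => k).
Proof. by elim: k => [|k IH]; [exact: pr_zero | exact: (pr_comp pr_succ IH)]. Qed.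

Lemma pr_S A : pr A -> pr (fun X x => (A X x).+1).
Proof. exact: (pr_comp pr_succ). Qed.

Lemma pr_rec (a : (nat -> bool) -> nat -> nat) h A :
  pr a -> pr A -> pr (fun X z => h X (pfst z) (pfst (psnd z)) (psnd (psnd z))) ->
  pr (fun X x => nat_rect (fun=> nat) (a X x) (h X x) (A X x)).
Proof.
move=> pa pA ph.
(* The function iterated by [pr_iter] sees nothing but its state and the oracle, so the state
   carries the parameter, the counter and the accumulator. *)
pose st X s := pairing (pfst s) (pairing (pfst (psnd s)).+1
    (h X (pfst s) (pfst (psnd s)) (psnd (psnd s)))).
have pst : pr st.
  apply: pr_pair pr_fst _; apply: pr_pair; last exact: ph.
  exact: pr_S (pr_comp pr_fst pr_snd).
have := pr_comp pr_snd (pr_comp pr_snd (pr_comp (pr_iter pst)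
   (pr_pair pA (pr_pair pr_id (pr_pair pr_zero pa))))).
move/pr_ext; apply=> X x; rewrite pfst_pairing psnd_pairing.
suff -> : forall n, iter n (st X) (pairing x (pairing 0 (a X x))) =
   pairing x (pairing n (nat_rect (fun=> nat) (a X x) (h X x) n)).
  by rewrite !psnd_pairing.
by elim=> //= n ->; rewrite /st !(pfst_pairing, psnd_pairing).
Qed.

Lemma pr_iter_gen h a A :
  pr a -> pr A -> pr (fun X z => h X (pfst z) (psnd z)) ->
  pr (fun X x => iter (A X x) (h X x) (a X x)).
Proof.
move=> pa pA ph.
apply: (pr_ext (F := fun X x => nat_rect (fun=> nat) (a X x) (fun _ => h X x) (A X x))).
  apply: (pr_rec (h := fun X x _ => h X x)) => //.
  have := pr_comp ph (pr_pair pr_fst (pr_comp pr_snd pr_snd)).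
  by move/pr_ext; apply=> X x; rewrite pfst_pairing psnd_pairing.
by move=> X x; elim: (A X x) => //= n ->.
Qed.

Lemma pr_if (b : (nat -> bool) -> nat -> bool) A B :
  pr (fun X x => b X x) -> pr A -> pr B -> pr (fun X x => if b X x then A X x else B X x).
Proof.
move=> pb pA pB.
apply: (pr_ext (F := fun X x => iter (b X x) (fun=> A X x) (B X x))).
  apply: (pr_iter_gen (h := fun X x _ => A X x)) => //.
  exact: (pr_comp pA pr_fst).
by move=> X x; case: (b X x).
Qed.
End Closure.

Lemma pr_pred : pr1 predn.
Proof.
apply: (pr_ext (F := fun _ x => nat_rect (fun=> nat) 0 (fun i _ => i) x)).
  apply: (pr_rec (a := fun _ _ => 0) (h := fun _ _ i _ => i)); first exact: pr_zero.
    exact: pr_id.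
  exact: (pr_comp pr_fst pr_snd).
by move=> _ [].
Qed.

Lemma pr_add : pr2 addn.
Proof.
apply: (pr_ext (F := fun _ x => iter (pfst x) succn (psnd x))).
  apply: (pr_iter_gen (h := fun _ _ => succn)); [exact: pr_snd|exact: pr_fst|].
  exact: pr_S pr_snd.
by move=> _ x; rewrite iter_succn addnC.
Qed.

Lemma pr_sub : pr2 subn.
Proof.
apply: (pr_ext (F := fun _ x => iter (psnd x) predn (pfst x))).
  apply: (pr_iter_gen (h := fun _ _ => predn)); [exact: pr_fst|exact: pr_snd|].
  exact: (pr_comp pr_pred pr_snd).
by move=> _ x; rewrite iter_predn.
Qed.

(* Here and below, opacity keeps conversion from computing with codes. *)
Opaque pfst psnd pairing.

Section BoolClosure.
Implicit Types A B : (nat -> bool) -> nat -> nat.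
Implicit Types P Q : (nat -> bool) -> nat -> bool.

Lemma pr_leq A B : pr A -> pr B -> pr (fun X x => A X x <= B X x).
Proof.
move=> pA pB; apply: (pr_ext (pr_app2 pr_sub (pr_const 1) (pr_app2 pr_sub pA pB))) => X x.
by rewrite -subn_eq0; case: (A X x - B X x).
Qed.

Lemma pr_neg P : pr (fun X x => P X x) -> pr (fun X x => ~~ P X x).
Proof.
move=> pP; apply: (pr_ext (pr_app2 pr_sub (pr_const 1) pP)) => X x.
by case: (P X x).
Qed.

Lemma pr_and P Q : pr (fun X x => P X x) -> pr (fun X x => Q X x) ->
  pr (fun X x => P X x && Q X x).
Proof.
move=> pP pQ; apply: (pr_ext (pr_if pP pQ pr_zero)) => X x.
by case: (P X x).
Qed.

Lemma pr_or P Q : pr (fun X x => P X x) -> pr (fun X x => Q X x) ->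
  pr (fun X x => P X x || Q X x).
Proof.
move=> pP pQ; apply: (pr_ext (pr_if pP (pr_const 1) pQ)) => X x.
by case: (P X x).
Qed.

Lemma pr_imp P Q : pr (fun X x => P X x) -> pr (fun X x => Q X x) ->
  pr (fun X x => P X x ==> Q X x).
Proof.
move=> pP pQ; apply: (pr_ext (pr_if pP pQ (pr_const 1))) => X x.
by case: (P X x).
Qed.

Lemma pr_eq A B : pr A -> pr B -> pr (fun X x => A X x == B X x).
Proof.
move=> pA pB.
apply: (pr_ext (pr_and (pr_leq pA pB) (pr_leq pB pA))) => X x.
by rewrite eqn_leq.
Qed.

Lemma pr_eqb P Q : pr (fun X x => P X x) -> pr (fun X x => Q X x) ->
  pr (fun X x => P X x == Q X x).
Proof.
move=> pP pQ; apply: (pr_ext (pr_if pP pQ (pr_neg pQ))) => X x.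
by case: (P X x); case: (Q X x).
Qed.

Lemma pr_ifb P (Q R : (nat -> bool) -> nat -> bool) : pr (fun X x => P X x) ->
  pr (fun X x => Q X x) -> pr (fun X x => R X x) ->
  pr (fun X x => if P X x then Q X x else R X x).
Proof.
move=> pP pQ pR; apply: (pr_ext (pr_if pP pQ pR)) => X x.
by case: (P X x).
Qed.

Lemma pr_find (p : (nat -> bool) -> nat -> nat -> bool) A :
  pr A -> pr (fun X z => p X (pfst z) (psnd z)) ->
  pr (fun X x => find (p X x) (iota 0 (A X x))).
Proof.
move=> pA pp.
(* The accumulator equals the index as long as no witness has been met and is frozen afterwards; on
   failure it ends as the length, just as [find] does. *)
pose h X x i acc := if (acc == i) && ~~ p X x i then i.+1 else acc.
apply: (pr_ext (F := fun X x => nat_rect (fun=> nat) 0 (h X x) (A X x))).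
  apply: pr_rec => //; first exact: pr_zero.
  apply: (pr_if (b := fun X z => _ && ~~ p X (pfst z) (pfst (psnd z)))).
  - apply: pr_and; last apply: pr_neg.
      by apply: pr_eq; [exact: (pr_comp pr_snd pr_snd)|exact: (pr_comp pr_fst pr_snd)].
    have /pr_ext := pr_comp pp (pr_pair pr_fst (pr_comp pr_fst pr_snd)).
    by apply=> X x; rewrite pfst_pairing psnd_pairing.
  - exact: pr_S (pr_comp pr_fst pr_snd).
  - exact: (pr_comp pr_snd pr_snd).
move=> X x; move: (A X x) => m; elim: m => // n IH; rewrite -addn1 iotaD addn1 /= {}IH.
rewrite find_cat size_iota add0n /h has_find size_iota.
have := find_size (p X x) (iota 0 n); rewrite size_iota leq_eqVlt.
case/orP => [/eqP -> | lt]; last by rewrite lt (ltn_eqF lt).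
by rewrite eqxx ltnn /=; case: (p X x n); rewrite ?addn0 ?addn1.
Qed.

Lemma pr_all (p : (nat -> bool) -> nat -> nat -> bool) A :
  pr A -> pr (fun X z => p X (pfst z) (psnd z)) ->
  pr (fun X x => all (p X x) (iota 0 (A X x))).
Proof.
move=> pA pp.
have pf := pr_find (p := fun X x i => ~~ p X x i) pA (pr_neg pp).
apply: (pr_ext (pr_leq pA pf)) => X x.
by rewrite -[all _ _]negbK -has_predC has_find size_iota -leqNgt.
Qed.
End BoolClosure.

(* Automated membership proofs, and arithmetic and finite maps as primitive recursive operators *)
Create HintDb prdb.
#[local] Hint Resolve pr_pred pr_add pr_sub pr_pair : prdb.

Ltac prstep :=
  first [refine (pr_const _) |
  lazymatch goal with
  | |- pr1 _ => rewrite /pr1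
  | |- pr2 _ => rewrite /pr2
  | |- pr3 _ => rewrite /pr3
  | |- pr4 _ => rewrite /pr4
  | |- pr (fun X x => x) => exact: pr_id
  | |- pr (fun X x => nat_of_bool (X (@?A X x))) => apply: (@pr_comp _ A pr_orc)
  | |- pr (fun X x => nat_of_bool (@?A X x <= @?B X x)) => apply: (@pr_leq A B)
  | |- pr (fun X x => nat_of_bool (~~ (@?A X x))) => apply: (@pr_neg A)
  | |- pr (fun X x => nat_of_bool (@?A X x && @?B X x)) => apply: (@pr_and A B)
  | |- pr (fun X x => nat_of_bool (@?A X x || @?B X x)) => apply: (@pr_or A B)
  | |- pr (fun X x => nat_of_bool (@?A X x ==> @?B X x)) => apply: (@pr_imp A B)
  | |- pr (fun X x => nat_of_bool (eq_op (@?A X x) (@?B X x))) =>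
      first [apply: (@pr_eq A B) | apply: (@pr_eqb A B)]
  | |- pr (fun X x => nat_of_bool (all (@?p X x) (iota 0 (@?A X x)))) => apply: (@pr_all p A)
  | |- pr (fun X x => find (@?p X x) (iota 0 (@?A X x))) => apply: (@pr_find p A)
  | |- pr (fun X x => iter (@?A X x) (@?h X x) (@?a X x)) => apply: (@pr_iter_gen h a A)
  | |- pr (fun X x => nat_rect _ (@?a X x) (@?h X x) (@?A X x)) => apply: (@pr_rec a h A)
  | |- pr (fun X x => (@?A X x).+1) => apply: (@pr_S A)
  | |- pr (fun X x => pfst (@?A X x)) => apply: (@pr_comp _ A pr_fst)
  | |- pr (fun X x => psnd (@?A X x)) => apply: (@pr_comp _ A pr_snd)
  | |- pr (fun X x => pairing (@?A X x) (@?B X x)) => apply: (@pr_pair A B)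
  | |- pr (fun X x => ?f (@?A X x) (@?B X x) (@?D X x) (@?E X x)) =>
      apply: (@pr_app4 f A B D E); first by eauto with prdb nocore
  | |- pr (fun X x => nat_of_bool (?f (@?A X x) (@?B X x) (@?D X x) (@?E X x))) =>
      apply: (@pr_app4 (fun a b d e => nat_of_bool (f a b d e)) A B D E);
      first by eauto with prdb nocore
  | |- pr (fun X x => ?f (@?A X x) (@?B X x) (@?D X x)) =>
      apply: (@pr_app3 f A B D); first by eauto with prdb nocore
  | |- pr (fun X x => nat_of_bool (?f (@?A X x) (@?B X x) (@?D X x))) =>
      apply: (@pr_app3 (fun a b d => nat_of_bool (f a b d)) A B D);
      first by eauto with prdb nocore
  | |- pr (fun X x => ?f (@?A X x) (@?B X x)) =>
      apply: (@pr_app2 f A B); first by eauto with prdb nocore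
  | |- pr (fun X x => nat_of_bool (?f (@?A X x) (@?B X x))) =>
      apply: (@pr_app2 (fun a b => nat_of_bool (f a b)) A B); first by eauto with prdb nocore
  | |- pr (fun X x => nat_of_bool (?f (@?A X x))) =>
      apply: (@pr_app1 (fun a => nat_of_bool (f a)) A); first by eauto with prdb nocore
  | |- pr (fun X x => nat_of_bool _) => refine (@pr_ifb _ _ _ _ _ _)
  | |- pr (fun X x => ?f (@?A X x)) =>
      apply: (@pr_app1 f A); first by eauto with prdb nocore
  | |- pr _ => refine (@pr_if _ _ _ _ _ _)
  end]; cbv beta.
Ltac prs := repeat prstep.

Lemma pr_mul : pr2 muln.
Proof.
apply: (pr_ext (F := fun _ x => iter (pfst x) (addn (psnd x)) 0)); first by prs.
by move=> _ x; rewrite iter_addn_0 mulnC.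
Qed.
#[local] Hint Resolve pr_mul : prdb.

Lemma pr_div3 : pr1 (fun z => z %/ 3).
Proof.
(* The quotient is the first [i] with [z < 3 * i.+1]; for [z = 0] the empty range returns the right
   value 0. *)
apply: (pr_ext (F := fun _ z => find (fun i => z < 3 * i.+1) (iota 0 z))).
  by prs.
move=> _ z; have [z0|z0] := posnP z; first by rewrite z0.
have lt : z %/ 3 < z by rewrite ltn_Pdiv.
have pz : z < 3 * (z %/ 3).+1 by lia.
have le : find (fun i => z < 3 * i.+1) (iota 0 z) <= z %/ 3.
  rewrite leqNgt; apply/negP => /(before_find 0) /=.
  by rewrite nth_iota // add0n pz.
have /(nth_find 0) : has (fun i => z < 3 * i.+1) (iota 0 z).
  by rewrite has_find size_iota (leq_ltn_trans le).
rewrite nth_iota ?add0n; last exact: leq_ltn_trans le lt.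
by move: (find _ _) le => f le h; apply/eqP; rewrite eqn_leq le; lia.
Qed.

Lemma pr_mod3 : pr1 (fun z => z %% 3).
Proof.
apply: (pr_ext (F := fun _ z => z - z %/ 3 * 3)).
  by prs; apply: (pr_comp pr_div3 pr_id).
by move=> _ z; rewrite {1}(divn_eq z 3) addKn.
Qed.

(* Finite maps on [nat] with default value [0] are coded as association lists. *)
Definition put (c k v : nat) : nat := (pairing (pairing k v) c).+1.

(** One step of a lookup. The empty list and a list headed by the key [k] are fixed points and any
    other step lowers the code, so [c] iterations suffice in [get]. *)
Definition get_skip (k c : nat) : nat :=
  if (c == 0) || (pfst (pfst c.-1) == k) then c else psnd c.-1.

Definition get (k c : nat) : nat := psnd (pfst (iter c (get_skip k) c).-1).

Lemma iter_fixed T (f : T -> T) x n : f x = x -> iter n f x = x.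
Proof. by move=> e; elim: n => //= n ->. Qed.

Lemma get_skip_stable k c n : c <= n ->
  iter n (get_skip k) c = iter c (get_skip k) c.
Proof.
elim/ltn_ind: c n => -[|c] IH n le; first by rewrite iter_fixed.
case: n le => // n; rewrite ltnS => le.
have [e|ne] := boolP (pfst (pfst c) == k).
  by rewrite !iter_fixed // /get_skip /= e.
rewrite !iterSr [get_skip k c.+1]/get_skip /= (negPf ne).
have h := psnd_leq c.
by rewrite (IH (psnd c)) ?ltnS // ?(leq_trans h) // (IH (psnd c) _ c).
Qed.

Lemma get0 k : get k 0 = 0.
Proof. by []. Qed.

Lemma get_put k c j v : get k (put c j v) = if j == k then v else get k c.
Proof.
rewrite /get /put; set p := pairing _ _.
have e1 : pfst p = pairing j v by rewrite pfst_pairing.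
have e2 : psnd p = c by rewrite psnd_pairing.
have sk : get_skip k p.+1 = if j == k then p.+1 else c.
  by rewrite /get_skip /= e1 pfst_pairing e2.
case: ifP sk => _ sk; first by rewrite iter_fixed //= e1 psnd_pairing.
by rewrite iterSr sk get_skip_stable // -e2 psnd_leq.
Qed.

(** Validity of a string asks that the code of its bits be at least its length; an entry written at
    the length itself ensures this. *)
Lemma put_gtk c k v : k < put c k v.
Proof. by rewrite ltnS (leq_trans (pairing_gel k v)) ?pairing_gel. Qed.

Lemma pr_put : pr3 put.
Proof. by rewrite /put; prs. Qed.

Lemma pr_get_skip : pr2 get_skip.
Proof. by rewrite /get_skip; prs. Qed.
#[local] Hint Resolve pr_put pr_get_skip : prdb.

Lemma pr_get : pr2 get.
Proof. by rewrite /get; prs. Qed.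
#[local] Hint Resolve pr_get : prdb.

Definition tab (p : nat -> nat) (n : nat) : nat :=
  nat_rect (fun=> nat) 0 (fun i acc => put acc i (p i)) n.

Lemma tabS p n : tab p n.+1 = put (tab p n) n (p n).
Proof. by []. Qed.

Lemma get_tab p n k : get k (tab p n) = if k < n then p k else 0.
Proof.
elim: n => [|n IH]; first by rewrite ltn0.
rewrite [tab _ _]/(put (tab p n) n (p n)) get_put {}IH ltnS.
by case: (ltngtP k n) => // ->.
Qed.

Lemma eq_tab p q n : (forall k, k < n -> p k = q k) -> tab p n = tab q n.
Proof.
elim: n => //= n IH e; rewrite /tab /= -!/(tab _ _) IH ?e // => k lt.
by rewrite e // ltnW.
Qed.

Lemma pr_tab (p : (nat -> bool) -> nat -> nat -> nat) A :
  pr A -> pr (fun X z => p X (pfst z) (psnd z)) ->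
  pr (fun X x => tab (p X x) (A X x)).
Proof.
move=> pA pp; rewrite /tab.
apply: (pr_rec (h := fun X x i acc => put acc i (p X x i))) => //; first by prs.
apply: (pr_app3 pr_put) => //; first by prs.
  by prs.
have /pr_ext := pr_comp pp (pr_pair pr_fst (pr_comp pr_fst pr_snd)).
by apply=> X x; rewrite pfst_pairing psnd_pairing.
Qed.

Ltac prs ::= repeat first
  [ match goal with
    | |- pr (fun X x => tab (@?p X x) (@?A X x)) => apply: (@pr_tab p A); cbv beta
    | |- pr (fun X x => @?A X x %/ 3) => apply: (pr_app1 pr_div3 (A := A)); cbv beta
    | |- pr (fun X x => @?A X x %% 3) => apply: (pr_app1 pr_mod3 (A := A)); cbv beta
    end
  | prstep ].

Opaque get put tab.

(** * Universal simulation *)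

(** The pairing is the one behind the pickling of sequences, so [pfst] and [psnd] take coded
    programs apart. *)
Lemma code_cons n s : CodeSeq.code (n :: s) = (pairing n (CodeSeq.code s)).+1.
Proof. by rewrite pairingS addn1 mul2n. Qed.

Lemma decodeS z : CodeSeq.decode z.+1 = pfst z :: CodeSeq.decode (psnd z).
Proof.
by apply: (can_inj CodeSeq.codeK); rewrite code_cons !CodeSeq.decodeK pairing_eta.
Qed.

(** An instruction is pickled as a two-element list: first the code of the list of its kind and
    register, then its jump address. [ivalid] tests this shape. *)
Definition ikind a := pfst (pfst a.-1).-1.
Definition ireg a := pfst (psnd (pfst a.-1).-1).-1.
Definition ijump a := pfst (psnd a.-1).-1.
Definition ivalid a :=
  [&& 0 < a, 0 < psnd a.-1, psnd (psnd a.-1).-1 == 0, 0 < pfst a.-1,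
      0 < psnd (pfst a.-1).-1, psnd (psnd (pfst a.-1).-1).-1 == 0 & ikind a <= 2].
Definition imk a : instr :=
  if ikind a == 0 then Inc (ireg a)
  else if ikind a == 1 then Dec (ireg a) (ijump a) else Orc (ireg a).

Lemma unpickle_pair (S T : countType) a : unpickle a =
  if [&& 0 < a, 0 < psnd a.-1 & psnd (psnd a.-1).-1 == 0]
  then obind (fun x : S => obind (fun y : T => Some (x, y)) (unpickle (pfst (psnd a.-1).-1)))
         (unpickle (pfst a.-1))
  else None.
Proof.
rewrite {1}/unpickle /= /pcomp [X in obind _ X]/unpickle /= /unpickle_tagged.
case: a => [//|a]; rewrite decodeS [a.+1.-1]/=.
case: (psnd a) => [//|b]; rewrite decodeS [b.+1.-1]/=.
by case: (psnd b) => [|c]; rewrite ?decodeS //=;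
  do 2?[case: (unpickle _) => [?|] //=].
Qed.

Lemma unpickle_instr a : unpickle a = if ivalid a then Some (imk a) else None.
Proof.
rewrite {1}/unpickle /= /pcomp unpickle_pair unpickle_pair.
rewrite /ivalid /imk /ikind /ireg /ijump.
move: (pfst a.-1) (psnd a.-1) => u t.
move: (pfst u.-1) (psnd u.-1) (pfst t.-1) (psnd t.-1 == 0) => k r j b.
move: (pfst r.-1) (psnd r.-1 == 0) => i b'.
move: (0 < a) (0 < t) (0 < u) (0 < r) => c1 c2 c3 c4.
by case: c1 c2 b c3 c4 b' => [] [] [] [] [] []; case: k => [|[|[|k]]].
Qed.

(* Skips one entry of a coded program: [pairing k c] asks for the [k]-th
   instruction of [c], the entries that code no instruction being dropped. *)
Definition fetch_step s :=
  if psnd s == 0 then s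
  else if ivalid (pfst (psnd s).-1) then
    (if pfst s == 0 then s else pairing (pfst s).-1 (psnd (psnd s).-1))
  else pairing (pfst s) (psnd (psnd s).-1).

Definition fetch e pc := psnd (iter e fetch_step (pairing pc e)).

Lemma pr_ikind : pr1 ikind. Proof. by rewrite /ikind; prs. Qed.
Lemma pr_ireg : pr1 ireg. Proof. by rewrite /ireg; prs. Qed.
Lemma pr_ijump : pr1 ijump. Proof. by rewrite /ijump; prs. Qed.
#[local] Hint Resolve pr_ikind pr_ireg pr_ijump : prdb.
Lemma pr_ivalid : pr1 ivalid. Proof. by rewrite /ivalid; prs. Qed.
#[local] Hint Resolve pr_ivalid : prdb.
Lemma pr_fetch_step : pr1 fetch_step. Proof. by rewrite /fetch_step; prs. Qed.
#[local] Hint Resolve pr_fetch_step : prdb.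
Lemma pr_fetch : pr2 fetch. Proof. by rewrite /fetch; prs. Qed.
#[local] Hint Resolve pr_fetch : prdb.

Lemma prog_ofE z : prog_of z = pmap unpickle (CodeSeq.decode z).
Proof. by []. Qed.

Lemma prog_ofS z :
  prog_of z.+1 = if ivalid (pfst z) then imk (pfst z) :: prog_of (psnd z)
                 else prog_of (psnd z).
Proof.
rewrite !prog_ofE decodeS [pmap _ (_ :: _)]/= unpickle_instr.
by case: (ivalid _).
Qed.

Lemma fetchP e pc :
  if pc < size (prog_of e) then
    0 < fetch e pc /\ nth (Inc 0) (prog_of e) pc = imk (pfst (fetch e pc).-1)
  else fetch e pc = 0.
Proof.
have fs0 k : fetch_step (pairing k 0) = pairing k 0.
  by rewrite /fetch_step psnd_pairing.
rewrite /fetch.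
suff main n : e <= n -> forall s, s = iter n fetch_step (pairing pc e) ->
  if pc < size (prog_of e) then
    0 < psnd s /\ nth (Inc 0) (prog_of e) pc = imk (pfst (psnd s).-1)
  else psnd s = 0 by exact: main (leqnn e) _ erefl.
elim/ltn_ind: e pc n => -[|e] IH pc n le s es.
  by rewrite es iter_fixed // psnd_pairing.
case: n le es => // n; rewrite ltnS => le; rewrite prog_ofS.
have st : fetch_step (pairing pc e.+1) =
  if ivalid (pfst e) then if pc == 0 then pairing pc e.+1
     else pairing pc.-1 (psnd e) else pairing pc (psnd e).
  by rewrite /fetch_step psnd_pairing pfst_pairing.
have lt := psnd_leq e; have le' := leq_trans lt le.
case: (ivalid (pfst e)) st; last by rewrite iterSr => -> es; apply: (IH _ _ _ n).
case: pc => [|pc] st es; first by rewrite es iter_fixed // psnd_pairing.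
by rewrite iterSr st in es; apply: (IH _ _ _ n _ s).
Qed.

(* Configurations are coded as [pairing pc rho], with [rho] a finite map; an
   oracle string is coded as [pairing w c], the answers to the queries below [w]
   being the bits of the finite map [c].  Other queries block the simulation. *)
Definition bit (c z : nat) : bool := 0 < get z c.

Opaque fetch ikind ireg ijump ivalid.

Definition sim_step (e u s : nat) : nat :=
  if fetch e (pfst s) == 0 then s
  else if ikind (pfst (fetch e (pfst s)).-1) == 0 then
    pairing (pfst s).+1 (put (psnd s) (ireg (pfst (fetch e (pfst s)).-1))
      (get (ireg (pfst (fetch e (pfst s)).-1)) (psnd s)).+1)
  else if ikind (pfst (fetch e (pfst s)).-1) == 1 then
    if get (ireg (pfst (fetch e (pfst s)).-1)) (psnd s) == 0
    then pairing (ijump (pfst (fetch e (pfst s)).-1)) (psnd s)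
    else pairing (pfst s).+1 (put (psnd s) (ireg (pfst (fetch e (pfst s)).-1))
      (get (ireg (pfst (fetch e (pfst s)).-1)) (psnd s)).-1)
  else if get (ireg (pfst (fetch e (pfst s)).-1)) (psnd s) < pfst u then
    pairing (pfst s).+1 (put (psnd s) (ireg (pfst (fetch e (pfst s)).-1))
      (bit (psnd u) (get (ireg (pfst (fetch e (pfst s)).-1)) (psnd s))))
  else s.

Definition sim_end (e u x : nat) : nat :=
  iter (pfst u) (sim_step e u) (pairing 0 (put 0 0 x)).

(* [0] if the simulation does not stop within [pfst u] steps, otherwise the
   output plus one. *)
Definition univ (e u x : nat) : nat :=
  if fetch e (pfst (sim_end e u x)) == 0 then (get 0 (psnd (sim_end e u x))).+1
  else 0.

Lemma pr_bit : pr2 bit. Proof. by rewrite /bit; prs. Qed.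
#[local] Hint Resolve pr_bit : prdb.
Lemma pr_sim_step : pr3 sim_step. Proof. by rewrite /sim_step; prs. Qed.
#[local] Hint Resolve pr_sim_step : prdb.
Lemma pr_sim_end : pr3 sim_end. Proof. by rewrite /sim_end; prs. Qed.
#[local] Hint Resolve pr_sim_end : prdb.
Lemma pr_univ : pr3 univ. Proof. by rewrite /univ; prs. Qed.
#[local] Hint Resolve pr_univ : prdb.

Definition codes_regs (rho : nat) (r : regs) := forall k, get k rho = r k.

Lemma codes_upd rho r k v : codes_regs rho r -> codes_regs (put rho k v) (upd r k v).
Proof. by move=> cr i; rewrite get_put /upd eq_sym cr. Qed.

Definition agrees (X : nat -> bool) (u : nat) := forall z, z < pfst u -> bit (psnd u) z = X z.

Definition query (i : instr) (r : regs) := if i is Orc k then (r k).+1 else 0.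

(** A query outside the string leaves the simulation at a genuine instruction, so a blocked run is
    never mistaken for a halted one. *)
Lemma sim_stepP X e u pc r rho i :
  codes_regs rho r -> pc < size (prog_of e) -> i = nth (Inc 0) (prog_of e) pc ->
  if query i r <= pfst u then
    (forall z, z.+1 = query i r -> bit (psnd u) z = X z) ->
    exists rho', sim_step e u (pairing pc rho) = pairing (exec X i pc r).1 rho'
             /\ codes_regs rho' (exec X i pc r).2
  else sim_step e u (pairing pc rho) = pairing pc rho.
Proof.
move=> cr lt ->; have := fetchP e pc; rewrite lt => -[f0 ->].
rewrite /sim_step !(pfst_pairing, psnd_pairing).
move: (fetch e pc) f0 => [//|a] _; rewrite [a.+1.-1]/= /= /imk.
move: (ikind _) (ireg _) (ijump _) => k rg j; rewrite !cr.
case: k => [|[|k]] /=.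
- by move=> _; eexists; split; first reflexivity; apply: codes_upd.
- move=> _; case: (r rg == 0) => /=; first by exists rho.
  by eexists; split; first reflexivity; apply: codes_upd.
- case: (r rg < pfst u) => // /(_ (r rg) erefl) ->.
  by eexists; split; first reflexivity; apply: codes_upd.
Qed.

Lemma sim_step_halt e u pc rho : fetch e pc = 0 ->
  sim_step e u (pairing pc rho) = pairing pc rho.
Proof. by move=> f; rewrite /sim_step pfst_pairing f. Qed.

Lemma run_S X p f pc r :
  run X p f.+1 pc r = if pc < size p then
    run X p f (exec X (nth (Inc 0) p pc) pc r).1 (exec X (nth (Inc 0) p pc) pc r).2
  else Some r.
Proof. by rewrite /=; case: ifP => // _; case: (exec _ _ _ _). Qed.

Lemma codes_init x : codes_regs (put 0 0 x) (init x).
Proof. by move=> k; rewrite get_put get0 /init eq_sym. Qed.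

Lemma sim_sound X e u n pc rho r : agrees X u -> codes_regs rho r ->
  fetch e (pfst (iter n (sim_step e u) (pairing pc rho))) = 0 ->
  exists s r', run X (prog_of e) s pc r = Some r' /\
    r' 0 = get 0 (psnd (iter n (sim_step e u) (pairing pc rho))).
Proof.
move=> ag; elim: n pc rho r => [|n IH] pc rho r cr h.
  exists 1, r; rewrite run_S /= psnd_pairing cr; split=> //.
  have := fetchP e pc; case: ifP => // _; rewrite /= pfst_pairing in h.
  by rewrite h => -[].
have := fetchP e pc; case lt: (_ < _) => f; last first.
  exists 1, r; rewrite run_S lt iter_fixed ?sim_step_halt // psnd_pairing cr.
  by split.
have := sim_stepP X u cr lt erefl; case: ifP => [q|_ fx]; last first.
  by rewrite iter_fixed // pfst_pairing in h; rewrite h in f; case: f.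
case=> [z zq|rho' [e1 cr']]; first by apply: ag; rewrite zq.
rewrite iterSr e1 in h *; have [s [r' [rr gy]]] := IH _ _ _ cr' h.
by exists s.+1, r'; rewrite run_S lt.
Qed.

(** The use principle: a single [v] bounds both the number of steps and the queries of the run. *)
Lemma sim_complete X e s pc r r' : run X (prog_of e) s pc r = Some r' ->
  exists v, forall u rho, codes_regs rho r -> v <= pfst u ->
    (forall z, z < v -> bit (psnd u) z = X z) ->
    forall n, v <= n -> forall t, t = iter n (sim_step e u) (pairing pc rho) ->
    fetch e (pfst t) = 0 /\ get 0 (psnd t) = r' 0.
Proof.
elim: s pc r => // s IH pc r; rewrite run_S.
have := fetchP e pc; case lt: (_ < _) => f; last first.
  case=> <-; exists 0 => u rho cr _ _ n _ t ->.
  by rewrite iter_fixed ?sim_step_halt // pfst_pairing psnd_pairing cr.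
set i := nth _ _ _ => rr; have [v hv] := IH _ _ rr.
exists (v + query i r).+1 => u rho cr le ag n len t.
case: n len => // n; rewrite ltnS => len; rewrite iterSr.
have := @sim_stepP X e u pc r rho i cr lt erefl.
rewrite (leq_trans _ le); last by rewrite ltnW // ltnS leq_addl.
case=> [z zq|rho' [-> cr']]; first by apply: ag; rewrite zq; lia.
apply: hv => //; [lia|move=> z zv; apply: ag; lia|lia].
Qed.

Lemma univ_sound X e u x y : agrees X u -> univ e u x = y.+1 -> Phi X e x y.
Proof.
move=> ag; rewrite /univ; case: eqP => // h [<-].
by have [s [r' ?]] := sim_sound ag (codes_init x) h; exists s, r'.
Qed.

Lemma univ_complete X e x y : Phi X e x y ->
  exists v, forall u, v <= pfst u -> (forall z, z < v -> bit (psnd u) z = X z) ->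
    univ e u x = y.+1.
Proof.
case=> s [r' [/sim_complete [v hv] <-]]; exists v => u le ag.
by rewrite /univ; have [-> ->] := hv u _ (codes_init x) le ag _ le _ erefl.
Qed.

Lemma run_mono X p f g pc r r' : f <= g -> run X p f pc r = Some r' ->
  run X p g pc r = Some r'.
Proof.
elim: f g pc r => // f IH [|g] // pc r; rewrite ltnS !run_S => le.
by case: ifP => // _; apply: IH.
Qed.

Lemma Phi_inj X e x y y' : Phi X e x y -> Phi X e x y' -> y = y'.
Proof.
move=> [s [r [h <-]]] [s' [r' [h' <-]]].
have := run_mono (leq_maxl s s') h; rewrite (run_mono (leq_maxr s s') h').
by case=> ->.
Qed.

(** * Primitive recursive search on counter machines *)

(* [CLoop k c] is "while register k is nonzero, decrement it and do c"; compiled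
   code jumps unconditionally by testing register 1, which must stay 0. *)
Inductive cmd : Type :=
| CSkip
| CInc of nat
| CDec of nat
| COrc of nat
| CSeq of cmd & cmd
| CLoop of nat & cmd.

Inductive ev (X : nat -> bool) : cmd -> regs -> regs -> Prop :=
| ev_skip r : ev X CSkip r r
| ev_inc k r : ev X (CInc k) r (upd r k (r k).+1)
| ev_dec k r : ev X (CDec k) r (upd r k (r k).-1)
| ev_orc k r : ev X (COrc k) r (upd r k (X (r k)))
| ev_seq a b r r1 r2 : ev X a r r1 -> ev X b r1 r2 -> ev X (CSeq a b) r r2
| ev_loop0 k c r : r k = 0 -> ev X (CLoop k c) r r
| ev_loopS k c n r r1 r2 : r k = n.+1 -> ev X c (upd r k n) r1 -> r1 1 = 0 ->
    ev X (CLoop k c) r1 r2 -> ev X (CLoop k c) r r2.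

Fixpoint csize (c : cmd) : nat :=
  match c with
  | CSkip => 0
  | CInc _ | CDec _ | COrc _ => 1
  | CSeq a b => csize a + csize b
  | CLoop _ c => (csize c).+2
  end.

(** Jumps are absolute, hence the address [o] of the first instruction. A plain decrement also goes
    to the next instruction when its register is 0. *)
Fixpoint compile (o : nat) (c : cmd) : program :=
  match c with
  | CSkip => [::]
  | CInc k => [:: Inc k]
  | CDec k => [:: Dec k o.+1]
  | COrc k => [:: Orc k]
  | CSeq a b => compile o a ++ compile (o + csize a) b
  | CLoop k c => Dec k (o + (csize c).+2) :: rcons (compile o.+1 c) (Dec 1 o)
  end.

Lemma size_compile o c : size (compile o c) = csize c.
Proof.
elim: c o => //= [a IHa b IHb|k c IH] o; first by rewrite size_cat IHa IHb.
by rewrite size_rcons IH.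
Qed.

(** The remaining fuel is arbitrary, so that runs compose and diverging computations are covered as
    well. *)
Definition steps X p k pc r pc' r' :=
  forall f, run X p (k + f) pc r = run X p f pc' r'.

Lemma steps_trans X p k k' pc r pc1 r1 pc2 r2 :
  steps X p k pc r pc1 r1 -> steps X p k' pc1 r1 pc2 r2 ->
  steps X p (k + k') pc r pc2 r2.
Proof. by move=> h1 h2 f; rewrite -addnA h1 h2. Qed.

Lemma step1 X pre i post r pc' r' : exec X i (size pre) r = (pc', r') ->
  steps X (pre ++ i :: post) 1 (size pre) r pc' r'.
Proof.
move=> e f; rewrite add1n run_S size_cat /= nth_cat ltnn subnn /= e.
by rewrite ifT // addnS ltnS leq_addr.
Qed.

Lemma upd_id r k : upd r k (r k) = r.
Proof. by apply: functional_extensionality => i; rewrite /upd; case: eqP => [->|]. Qed.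

Definition compiled X c r r' := forall pre post,
  exists k, steps X (pre ++ compile (size pre) c ++ post) k
    (size pre) r (size pre + csize c) r'.

(** Kept apart from [compileP] because the positive count [j.+1] is what later shows that an
    unsuccessful search diverges. *)
Lemma loop_once X k c n r r1 : compiled X c (upd r k n) r1 -> r k = n.+1 -> r1 1 = 0 ->
  forall pre post, exists j,
    steps X (pre ++ compile (size pre) (CLoop k c) ++ post) j.+1 (size pre) r (size pre) r1.
Proof.
move=> IHc rn r10 pre post /=.
have [kc hc] := IHc (rcons pre (Dec k (size pre + (csize c).+2)))
  (Dec 1 (size pre) :: post).
exists (kc + 1); rewrite -[(kc + 1).+1]add1n addnA; apply: steps_trans.
  apply: steps_trans; first by apply: step1; rewrite /= rn /=; reflexivity.
  rewrite size_rcons cat_rcons in hc.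
  by rewrite -cats1 -catA; exact: hc.
have := @step1 X (pre ++ Dec k (size pre + (csize c).+2) :: compile (size pre).+1 c)
  (Dec 1 (size pre)) post r1 (size pre) r1.
rewrite size_cat /= size_compile addnS addSn -cats1 -!catA /=.
by apply; rewrite r10.
Qed.

Lemma compileP X c r r' : ev X c r r' -> compiled X c r r'.
Proof.
elim=> {c r r'} [r|k r|k r|k r|a b r r1 r2 _ IHa _ IHb|k c r r0
  |k c n r r1 r2 rn _ IHc r10 _ IHl] pre post /=.
- by exists 0; rewrite addn0.
- by exists 1; apply: step1; rewrite addn1.
- exists 1; apply: step1; rewrite addn1 /=; case: eqP => // r0.
  by rewrite r0 /= -[X in (_, X)](upd_id r k) r0.
- by exists 1; apply: step1; rewrite addn1.
- have [ka ha] := IHa pre (compile (size pre + csize a) b ++ post).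
  have [kb hb] := IHb (pre ++ compile (size pre) a) post.
  exists (ka + kb); rewrite -catA.
  rewrite size_cat size_compile -!catA -addnA in hb.
  exact: steps_trans ha hb.
- by exists 1; apply: step1; rewrite /= r0.
- have [kc hc] := loop_once IHc rn r10 pre post.
  have [kl hl] := IHl pre post.
  by exists (kc.+1 + kl); apply: steps_trans hl.
Qed.

(** * Register windows and programs for pairing and unpairing *)

Definition win (r : regs) (b : nat) (l : seq nat) : regs :=
  fun i => if i < b then r i else nth 0 l (i - b).

Lemma winE r b l j : win r b l (b + j) = nth 0 l j.
Proof. by rewrite /win ltnNge leq_addr addKn. Qed.

Lemma win_lt r b l i : i < b -> win r b l i = r i.
Proof. by rewrite /win => ->. Qed.

Lemma upd_win r b l j v : upd (win r b l) (b + j) v = win r b (set_nth 0 l j v).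
Proof.
apply: functional_extensionality => i; rewrite /upd /win nth_set_nth /=.
case: (ltnP i b) => h.
  by rewrite ltn_eqF // (leq_trans h) ?leq_addr.
by rewrite -[X in X == b + j](subnKC h) eqn_add2l.
Qed.

Lemma eq_win r b l l' : (forall j, nth 0 l j = nth 0 l' j) -> win r b l = win r b l'.
Proof. by move=> e; apply: functional_extensionality => i; rewrite /win e. Qed.

Lemma ev_loop X k c m (S : nat -> regs) :
  (forall n, n <= m -> S n k = n) ->
  (forall n, n < m -> ev X c (upd (S n.+1) k n) (S n)) ->
  (forall n, n < m -> S n 1 = 0) -> ev X (CLoop k c) (S m) (S 0).
Proof.
elim: m => [|m IH] h1 h2 h3; first by apply: ev_loop0; rewrite h1.
apply: (ev_loopS (n := m) (r1 := S m)); [exact: h1|exact: h2|exact: h3|].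
by apply: IH => n lt; [apply: h1|apply: h2|apply: h3]; lia.
Qed.

Lemma ev_eq X c r r1 r2 : ev X c r r1 -> r1 = r2 -> ev X c r r2.
Proof. by move=> h <-. Qed.

Lemma ev_incw X r b l j : ev X (CInc (b + j)) (win r b l)
  (win r b (set_nth 0 l j (nth 0 l j).+1)).
Proof. by have := ev_inc X (b + j) (win r b l); rewrite upd_win winE. Qed.

Lemma ev_decw X r b l j : ev X (CDec (b + j)) (win r b l)
  (win r b (set_nth 0 l j (nth 0 l j).-1)).
Proof. by have := ev_dec X (b + j) (win r b l); rewrite upd_win winE. Qed.

Lemma ev_loopw X r b j c m (l : nat -> seq nat) : 1 < b -> r 1 = 0 ->
  (forall n, n <= m -> nth 0 (l n) j = n) ->
  (forall n, n < m -> ev X c (win r b (set_nth 0 (l n.+1) j n)) (win r b (l n))) ->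
  ev X (CLoop (b + j) c) (win r b (l m)) (win r b (l 0)).
Proof.
move=> b1 r1 h1 h2; apply: (@ev_loop X (b + j) c m (fun n => win r b (l n))) => n lt.
- by rewrite winE h1.
- by rewrite upd_win; apply: h2.
- by rewrite win_lt.
Qed.

(** A loop on a register holding 0 or 1 serves as a conditional, provided that the body leaves this
    register at 0. *)
Lemma ev_whenw X r b j c l l' (q : bool) : 1 < b -> r 1 = 0 ->
  nth 0 l j = q ->
  (if q then ev X c (win r b (set_nth 0 l j 0)) (win r b l') /\ nth 0 l' j = 0
   else forall i, nth 0 l i = nth 0 l' i) ->
  ev X (CLoop (b + j) c) (win r b l) (win r b l').
Proof.
move=> b1 r1 e; case: q e => e; last first.
  by move/eq_win <-; apply: ev_loop0; rewrite winE.
case=> h e'; apply: (ev_loopS (n := 0) (r1 := win r b l')).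
- by rewrite winE.
- by rewrite upd_win.
- by rewrite win_lt.
- by apply: ev_loop0; rewrite winE.
Qed.

Ltac nths := let j := fresh in move=> j; do 10?[case: j => [|j]]; rewrite //= ?nth_nil //; lia.

Ltac setnths := rewrite ?nth_set_nth /= ?nth_set_nth /= ?nth_set_nth /= ?nth_set_nth /=
  ?nth_set_nth /= ?nth_set_nth /=; repeat (case: eqP => /= ?); subst; rewrite //; lia.

Definition CMove b j k := CLoop (b + j) (CInc (b + k)).

(** While register 0 is counted down, register 1 holds the parity and register 2 the half of the
    rounds done; register 3 remembers within a round whether the parity was even. *)
Definition CHalf b := CLoop (b + 0) (CSeq (CInc (b + 3))
  (CSeq (CLoop (b + 1) (CSeq (CDec (b + 3)) (CInc (b + 2))))
        (CLoop (b + 3) (CInc (b + 1))))).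

Lemma ev_half X r b z f c : 1 < b -> r 1 = 0 ->
  ev X (CHalf b) (win r b [:: z; 0; 0; 0; f; c])
    (win r b [:: 0; nat_of_bool (odd z); z./2; 0; f; c]).
Proof.
move=> b1 r1.
have := @ev_loopw X r b 0 (CSeq (CInc (b + 3))
  (CSeq (CLoop (b + 1) (CSeq (CDec (b + 3)) (CInc (b + 2))))
        (CLoop (b + 3) (CInc (b + 1))))) z
  (fun n => [:: n; nat_of_bool (odd (z - n)); (z - n)./2; 0; f; c]) b1 r1.
rewrite subnn subn0; apply=> // n lt /=.
have -> : z - n = (z - n.+1).+1 by lia.
move: (z - n.+1) => t /=; rewrite uphalf_half.
apply: ev_seq; first exact: ev_incw.
apply: (ev_seq (r1 := win r b [:: n; 0; odd t + t./2; nat_of_bool (~~ odd t); f; c])).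
  apply: (ev_whenw (q := odd t)) => //=; case: (odd t); [|by nths].
  split=> //; apply: ev_seq; first exact: ev_decw.
  apply: ev_eq; first exact: ev_incw.
  by apply: eq_win; nths.
apply: (ev_whenw (q := ~~ odd t)) => //=; case: (odd t); [by nths|].
split=> //; apply: ev_eq; first exact: ev_incw.
by apply: eq_win; nths.
Qed.

(** By [pairing0] and [pairingSl] the first coordinate is the number of halvings that leave
    remainder 1 before one leaves 0, and the second is the final half. Register 4 flags another
    round, register 5 counts. *)
Definition CUnpair b := CSeq (CInc (b + 4)) (CLoop (b + 4) (CSeq (CHalf b)
  (CSeq (CLoop (b + 1) (CSeq (CInc (b + 4)) (CInc (b + 5)))) (CMove b 2 0)))).

Lemma ev_move X r b j k l l' : 1 < b -> r 1 = 0 -> j != k ->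
  (forall i, nth 0 l' i = if i == j then 0 else if i == k then nth 0 l k + nth 0 l j
     else nth 0 l i) ->
  ev X (CMove b j k) (win r b l) (win r b l').
Proof.
move=> b1 r1 ne e.
pose L n := set_nth 0 (set_nth 0 l k (nth 0 l k + nth 0 l j - n)) j n.
move/eqP: ne => ne.
have -> : win r b l = win r b (L (nth 0 l j)).
  by apply: eq_win => i; rewrite /L; setnths.
have -> : win r b l' = win r b (L 0).
  by apply: eq_win => i; rewrite e /L; setnths.
apply: ev_loopw => // n lt; first by rewrite nth_set_nth /= eqxx.
apply: ev_eq; first exact: ev_incw.
by apply: eq_win => i; rewrite /L; setnths.
Qed.

Lemma ev_unpair X r b z : 1 < b -> r 1 = 0 ->
  ev X (CUnpair b) (win r b [:: z]) (win r b [:: psnd z; 0; 0; 0; 0; pfst z]).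
Proof.
move=> b1 r1; apply: ev_seq; first exact: ev_incw.
suff main c : ev X (CLoop (b + 4) (CSeq (CHalf b)
    (CSeq (CLoop (b + 1) (CSeq (CInc (b + 4)) (CInc (b + 5)))) (CMove b 2 0))))
    (win r b [:: z; 0; 0; 0; 1; c]) (win r b [:: psnd z; 0; 0; 0; 0; c + pfst z]).
  suff <- : win r b [:: z; 0; 0; 0; 1; 0] =
      win r b (set_nth 0 [:: z] 4 (nth 0 [:: z] 4).+1) by apply: main.
  by apply: eq_win; nths.
elim/ltn_ind: z c => z IH c.
apply: (ev_loopS (n := 0) (r1 := win r b
    [:: z./2; 0; 0; 0; nat_of_bool (odd z); c + odd z])).
- by rewrite winE.
- rewrite upd_win; apply: ev_seq; first exact: ev_half.
  apply: (ev_seq (r1 := win r b [:: 0; 0; z./2; 0; nat_of_bool (odd z); c + odd z])).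
    apply: (ev_whenw (q := odd z)) => //=; case: (odd z); [|by nths].
    split=> //; apply: ev_seq; first exact: ev_incw.
    apply: ev_eq; first exact: ev_incw.
    by apply: eq_win; nths.
  by apply: ev_move => //; nths.
- by rewrite win_lt.
case oz: (odd z); last first.
  have [-> ->] := pfst_even oz.
  apply: ev_eq; first by apply: ev_loop0; rewrite winE.
  by apply: eq_win; nths.
have [-> ->] := pfst_odd oz; rewrite [nat_of_bool _]/= -[(pfst _).+1]add1n addnA.
by apply: IH; case: z oz => // z _; rewrite /= uphalf_half; lia.
Qed.

(** Starts from the double of [y] and applies the map from [t] to [2t + 1] as often as [x] says. *)
Definition CPair b := CSeq (CLoop (b + 1) (CSeq (CInc (b + 0)) (CInc (b + 0))))
  (CLoop (b + 2) (CSeq (CLoop (b + 0) (CSeq (CInc (b + 3)) (CInc (b + 3))))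
     (CSeq (CInc (b + 3)) (CMove b 3 0)))).

Lemma ev_pair X r b x y : 1 < b -> r 1 = 0 ->
  ev X (CPair b) (win r b [:: 0; y; x]) (win r b [:: pairing x y]).
Proof.
move=> b1 r1.
apply: (ev_seq (r1 := win r b [:: y.*2; 0; x])).
  have := @ev_loopw X r b 1 (CSeq (CInc (b + 0)) (CInc (b + 0))) y
    (fun n => [:: (y - n).*2; n; x]) b1 r1.
  rewrite subnn subn0; apply=> // n lt /=.
  apply: ev_seq; first exact: ev_incw.
  apply: ev_eq; first exact: ev_incw.
  by apply: eq_win; nths.
have -> : win r b [:: pairing x y] = win r b [:: pairing x y; 0; 0; 0].
  by apply: eq_win; nths.
have -> : win r b [:: y.*2; 0; x] = win r b [:: pairing 0 y; 0; x; 0].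
  by rewrite pairing0; apply: eq_win; nths.
have := @ev_loopw X r b 2 (CSeq (CLoop (b + 0) (CSeq (CInc (b + 3)) (CInc (b + 3))))
  (CSeq (CInc (b + 3)) (CMove b 3 0))) x (fun n => [:: pairing (x - n) y; 0; n; 0]) b1 r1.
rewrite subnn subn0; apply=> // n lt; rewrite [set_nth _ _ _ _]/=.
have -> : x - n = (x - n.+1).+1 by lia.
rewrite pairingSl; move: (pairing (x - n.+1) y) => t.
apply: (ev_seq (r1 := win r b [:: 0; 0; n; t.*2])).
  have := @ev_loopw X r b 0 (CSeq (CInc (b + 3)) (CInc (b + 3))) t
    (fun k => [:: k; 0; n; (t - k).*2]) b1 r1.
  rewrite subnn subn0; apply=> // k ltk /=.
  apply: ev_seq; first exact: ev_incw.
  apply: ev_eq; first exact: ev_incw.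
  by apply: eq_win; nths.
apply: ev_seq; first exact: ev_incw.
by apply: ev_move => //; nths.
Qed.

Definition CCopy b j k t := CSeq
  (CLoop (b + j) (CSeq (CInc (b + k)) (CInc (b + t)))) (CMove b t j).

Lemma ev_copy X r b j k t l l' : 1 < b -> r 1 = 0 -> uniq [:: j; k; t] ->
  nth 0 l t = 0 ->
  (forall i, nth 0 l' i = if i == k then nth 0 l k + nth 0 l j else nth 0 l i) ->
  ev X (CCopy b j k t) (win r b l) (win r b l').
Proof.
move=> b1 r1 un t0 e.
have [jk jt kt] : [/\ j <> k, j <> t & k <> t].
  by split=> h; move: un; rewrite h /= !inE eqxx ?orbT ?andbF.
pose L n := set_nth 0 (set_nth 0 (set_nth 0 l k (nth 0 l k + nth 0 l j - n)) j n)
  t (nth 0 l j - n).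
have -> : win r b l = win r b (L (nth 0 l j)).
  by apply: eq_win => i; rewrite /L; setnths.
apply: (ev_seq (r1 := win r b (L 0))).
  apply: ev_loopw => // n lt; first by rewrite /L; setnths.
  apply: ev_seq; first exact: ev_incw.
  apply: ev_eq; first exact: ev_incw.
  by apply: eq_win => i; rewrite /L; setnths.
apply: ev_move => //; first by apply/eqP => h; apply: jt.
by move=> i; rewrite e /L; setnths.
Qed.

Lemma ev_orcw X r b l j : ev X (COrc (b + j)) (win r b l)
  (win r b (set_nth 0 l j (X (nth 0 l j)))).
Proof. by have := ev_orc X (b + j) (win r b l); rewrite upd_win winE. Qed.

Lemma ev_clear X r b j l : 1 < b -> r 1 = 0 ->
  ev X (CLoop (b + j) CSkip) (win r b l) (win r b (set_nth 0 l j 0)).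
Proof.
move=> b1 r1.
have -> : win r b l = win r b (set_nth 0 l j (nth 0 l j)).
  by apply: eq_win => i; setnths.
apply: (@ev_loopw X r b j CSkip (nth 0 l j) (set_nth 0 l j)) => // n lt.
  by rewrite nth_set_nth /= eqxx.
apply: ev_eq; first exact: ev_skip.
by apply: eq_win => i; setnths.
Qed.

Lemma win_cat r b l1 l2 : win r b (l1 ++ l2) = win (win r b l1) (b + size l1) l2.
Proof.
apply: functional_extensionality => i; rewrite /win nth_cat.
case: (ltnP i b) => h1; first by rewrite ltn_addr.
by rewrite -(ltn_add2l b) subnKC // subnDA.
Qed.

Lemma win_rcons r b l x : win r b (rcons l x) = win (win r b l) (b + size l) [:: x].
Proof. by rewrite -cats1 win_cat. Qed.

(** Since the base is arbitrary and all registers below it are preserved, a subprogram is called by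
    placing its window behind the live registers of the caller. *)
Theorem pr_cmd F : pr F -> exists c : nat -> cmd, forall X r b x,
  1 < b -> r 1 = 0 -> ev X (c b) (win r b [:: x]) (win r b [:: F X x]).
Proof.
elim=> {F} [F G _ [c hc] e|||||||F G _ [cF hF] _ [cG hG]|F G _ [cF hF] _ [cG hG]|F _ [c hc]].
- by exists c => X r b x b1 r1; rewrite -e; apply: hc.
- by exists (fun=> CSkip) => X r b x _ _; apply: ev_skip.
- by exists (fun b => CLoop (b + 0) CSkip) => X r b x b1 r1; apply: ev_clear.
- by exists (fun b => CInc (b + 0)) => X r b x b1 r1; apply: ev_incw.
- exists (fun b => CSeq (CUnpair b) (CSeq (CLoop (b + 0) CSkip) (CMove b 5 0))).
  move=> X r b x b1 r1; apply: ev_seq; first exact: ev_unpair.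
  apply: ev_seq; first exact: ev_clear.
  by apply: ev_move => //; nths.
- exists (fun b => CSeq (CUnpair b) (CLoop (b + 5) CSkip)).
  move=> X r b x b1 r1; apply: ev_seq; first exact: ev_unpair.
  apply: ev_eq; first exact: ev_clear.
  by apply: eq_win; nths.
- by exists (fun b => COrc (b + 0)) => X r b x b1 r1; apply: ev_orcw.
- exists (fun b => CSeq (cG b) (cF b)) => X r b x b1 r1.
  by apply: ev_seq; [apply: hG|apply: hF].
- exists (fun b => CSeq (CCopy b 0 1 2) (CSeq (cG (b + 1)) (CSeq (CMove b 0 2)
    (CSeq (cF (b + 2)) (CPair b))))) => X r b x b1 r1.
  (* The form with [rcons] lets [win_rcons] shift the base to the last entry, on which the
     subprogram runs. *)
  apply: (ev_seq (r1 := win r b (rcons [:: x] x))).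
    by apply: ev_copy => //; nths.
  have w1 l : win r b l 1 = 0 by rewrite win_lt.
  apply: (ev_seq (r1 := win r b (rcons [:: x] (G X x)))).
    by rewrite !win_rcons; apply: hG; [lia | exact: w1].
  apply: (ev_seq (r1 := win r b (rcons [:: 0; G X x] x))).
    by apply: ev_move => //; nths.
  apply: (ev_seq (r1 := win r b (rcons [:: 0; G X x] (F X x)))).
    by rewrite !win_rcons; apply: hF; [lia | exact: w1].
  exact: ev_pair.
- exists (fun b => CSeq (CUnpair b) (CSeq (CMove b 0 1) (CSeq (CMove b 5 0)
    (CSeq (CLoop (b + 0) (c (b + 1))) (CMove b 1 0))))) => X r b x b1 r1.
  apply: ev_seq; first exact: ev_unpair.
  move: (pfst x) (psnd x) => m v.
  apply: (ev_seq (r1 := win r b [:: 0; v; 0; 0; 0; m])).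
    by apply: ev_move => //; nths.
  apply: (ev_seq (r1 := win r b [:: m; iter (m - m) (F X) v])).
    by rewrite subnn; apply: ev_move => //; nths.
  apply: (ev_seq (r1 := win r b [:: 0; iter (m - 0) (F X) v])); last first.
    by rewrite subn0; apply: ev_move => //; nths.
  apply: (@ev_loopw X r b 0 _ m (fun n => [:: n; iter (m - n) (F X) v])) => // n lt /=.
  have -> : m - n = (m - n.+1).+1 by lia.
  rewrite -![ [:: n; _]]/(rcons [:: n] _) !win_rcons /=.
  by apply: hc; [lia | rewrite win_lt].
Qed.

(** * The search program *)

Lemma upd_init v l w : upd (win (init v) 2 l) 0 w = win (init w) 2 l.
Proof. by apply: functional_extensionality => -[|[|i]]. Qed.

Lemma ev_inc0 X v l : ev X (CInc 0) (win (init v) 2 l) (win (init v.+1) 2 l).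
Proof. by have := ev_inc X 0 (win (init v) 2 l); rewrite upd_init. Qed.

Lemma ev_dec0 X v l : ev X (CDec 0) (win (init v) 2 l) (win (init v.-1) 2 l).
Proof. by have := ev_dec X 0 (win (init v) 2 l); rewrite upd_init. Qed.

(* Input x in register 0 and n in register 2. *)
Definition CPrelude := CSeq (CLoop 0 (CInc (2 + 1))) (CSeq (CMove 2 0 2) (CPair 2)).

Lemma ev_prelude X n x :
  ev X CPrelude (win (init x) 2 [:: n]) (win (init 0) 2 [:: pairing n x]).
Proof.
apply: (ev_seq (r1 := win (init 0) 2 [:: n; x])).
  have := @ev_loop X 0 (CInc (2 + 1)) x (fun m => win (init m) 2 [:: n; x - m]).
  rewrite subnn subn0.
  have -> : win (init x) 2 [:: n; 0] = win (init x) 2 [:: n] by apply: eq_win; nths.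
  apply=> // m lt; rewrite upd_init; apply: ev_eq; first exact: ev_incw.
  by apply: eq_win; nths.
by apply: ev_seq (ev_pair _ _ _ _ _) => //; apply: ev_move => //; nths.
Qed.

(** One round of the search. A value 0 leaves the flag in register 2 + 2 at 1 and the search goes
    on; a value [y.+1] clears it and leaves [y] in register 0. *)
Definition CBody (c : nat -> cmd) := CSeq (CCopy 2 1 4 6) (CSeq (CCopy 2 0 5 6)
  (CSeq (CPair (2 + 3)) (CSeq (c (2 + 3)) (CSeq (CInc (2 + 2))
  (CSeq (CLoop (2 + 3) (CSeq (CInc 0) (CDec (2 + 2)))) (CSeq (CDec 0) (CInc (2 + 1)))))))).

Lemma ev_body X c (F : nat -> nat) w q :
  (forall r b x, 1 < b -> r 1 = 0 -> ev X (c b) (win r b [:: x]) (win r b [:: F x])) ->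
  ev X (CBody c) (win (init 0) 2 [:: w; q])
    (win (init (F (pairing w q)).-1) 2 [:: w; q.+1; nat_of_bool (F (pairing w q) == 0)]).
Proof.
move=> hc.
apply: (ev_seq (r1 := win (init 0) 2 [:: w; q; 0; 0; q])).
  by apply: ev_copy => //; nths.
apply: (ev_seq (r1 := win (init 0) 2 ([:: w; q; 0] ++ [:: 0; q; w]))).
  by apply: ev_copy => //; nths.
have w1 : win (init 0) 2 [:: w; q; 0] 1 = 0 by [].
apply: (ev_seq (r1 := win (init 0) 2 ([:: w; q; 0] ++ [:: pairing w q]))).
  by rewrite !win_cat; apply: ev_pair.
apply: (ev_seq (r1 := win (init 0) 2 ([:: w; q; 0] ++ [:: F (pairing w q)]))).
  by rewrite !win_cat; apply: hc.
move: (F _) => m; apply: ev_seq; first exact: ev_incw.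
apply: (ev_seq (r1 := win (init m) 2 [:: w; q; nat_of_bool (m == 0); 0])).
  have := @ev_loop X (2 + 3) (CSeq (CInc 0) (CDec (2 + 2))) m
    (fun n => win (init (m - n)) 2 [:: w; q; nat_of_bool (m == n); n]).
  rewrite eqxx subnn subn0; apply=> // n lt.
  rewrite upd_win; apply: ev_seq; first exact: ev_inc0.
  have -> : (m - n.+1).+1 = m - n by lia.
  apply: ev_eq; first exact: ev_decw.
  rewrite (gtn_eqF lt); congr (win _ _ _) => /=; case: (m == n.+1) => //.
apply: ev_seq; first exact: ev_dec0.
apply: ev_eq; first exact: ev_incw.
by apply: eq_win; nths.
Qed.

Definition CSearch c := CSeq (CSeq CPrelude (CInc (2 + 2))) (CLoop (2 + 2) (CBody c)).

(** The parameter is hard-wired by [n] increments of register 2, which makes the code of the program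
    primitive recursive in [n]. *)
Definition search_prog c n : program := nseq n (Inc 2) ++ compile n (CSearch c).

Section SearchProg.
Variables (X : nat -> bool) (c : nat -> cmd) (F : nat -> nat) (n x : nat).
Hypothesis hc : forall r b x, 1 < b -> r 1 = 0 ->
  ev X (c b) (win r b [:: x]) (win r b [:: F x]).
Let w := pairing n x.
Let S q := win (init 0) 2 [:: w; q; 1].

Lemma steps_prefix k post : steps X (nseq k (Inc 2) ++ post) k 0 (init x)
  k (win (init x) 2 [:: k]).
Proof.
elim: k post => [|k IH] post.
  have -> : win (init x) 2 [:: 0] = init x.
    by apply: functional_extensionality => -[|[|[|i]]]; rewrite /win /= ?nth_nil.
  by move=> f.
have e : nseq k.+1 (Inc 2) ++ post = nseq k (Inc 2) ++ Inc 2 :: post.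
  by elim: k {IH} => //= k ->.
have := @step1 X (nseq k (Inc 2)) (Inc 2) post (win (init x) 2 [:: k]) k.+1
  (win (init x) 2 [:: k.+1]); rewrite size_nseq => st.
rewrite e; have := steps_trans (IH (Inc 2 :: post)) (st _); rewrite addn1; apply.
by congr (_, _); exact: (upd_win (init x) 2 [:: k] 0 k.+1).
Qed.

Lemma ev_search q :
  (forall q', q' < q -> F (pairing w q') = 0) -> 0 < F (pairing w q) ->
  exists2 r, ev X (CSearch c) (win (init x) 2 [:: n]) r & r 0 = (F (pairing w q)).-1.
Proof.
move=> h0 hq; exists (win (init (F (pairing w q)).-1) 2 [:: w; q.+1; 0]) => //.
apply: (ev_seq (r1 := S 0)).
  apply: ev_seq; first exact: ev_prelude.
  apply: ev_eq; first exact: ev_incw.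
  by apply: eq_win; nths.
suff: forall d k, k + d = q -> ev X (CLoop (2 + 2) (CBody c)) (S k)
  (win (init (F (pairing w q)).-1) 2 [:: w; q.+1; 0]) by apply.
elim=> [|d IH] k kd.
  rewrite addn0 in kd; rewrite {}kd.
  apply: (ev_loopS (n := 0) (r1 := win (init (F (pairing w q)).-1) 2
    [:: w; q.+1; nat_of_bool (F (pairing w q) == 0)])); first by [].
  - rewrite /S upd_win; have -> : win (init 0) 2 (set_nth 0 [:: w; q; 1] 2 0) =
      win (init 0) 2 [:: w; q] by apply: eq_win; nths.
    exact: ev_body.
  - by [].
  - by rewrite (gtn_eqF hq); apply: ev_loop0.
apply: (ev_loopS (n := 0) (r1 := S k.+1)); first by [].
- rewrite /S upd_win; have -> : win (init 0) 2 (set_nth 0 [:: w; k; 1] 2 0) =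
    win (init 0) 2 [:: w; k] by apply: eq_win; nths.
  by apply: ev_eq; [exact: (ev_body _ _ hc) | rewrite h0 //; lia].
- by [].
- by apply: IH; rewrite addSnnS.
Qed.

(** Every round costs at least one step and returns to the same address with the flag still set;
    induction on the fuel then excludes halting. *)
Lemma search_none f : (forall q, F (pairing w q) = 0) ->
  run X (search_prog c n) f 0 (init x) = None.
Proof.
move=> h0.
set pre := nseq n (Inc 2) ++ compile n (CSeq CPrelude (CInc (2 + 2))).
have sp : size pre = n + csize (CSeq CPrelude (CInc (2 + 2))).
  by rewrite /pre size_cat size_nseq size_compile.
have e : search_prog c n = pre ++ compile (size pre) (CLoop (2 + 2) (CBody c)) ++ [::].
  by rewrite cats0 sp /pre -catA.
have start : exists k, steps X (search_prog c n) k 0 (init x) (size pre) (S 0).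
  have ev0 : ev X (CSeq CPrelude (CInc (2 + 2))) (win (init x) 2 [:: n]) (S 0).
    apply: ev_seq; first exact: ev_prelude.
    apply: ev_eq; first exact: ev_incw.
    by apply: eq_win; nths.
  have [k hk] := compileP ev0 (nseq n (Inc 2)) (compile (size pre) (CLoop (2 + 2) (CBody c))).
  exists (n + k); apply: steps_trans (steps_prefix _ _) _.
  by move: hk; rewrite size_nseq sp.
have once q : exists k, steps X (search_prog c n) k.+1 (size pre) (S q) (size pre) (S q.+1).
  rewrite e; apply: (loop_once (n := 0)); last by [].
    apply: compileP; rewrite /S upd_win.
    have -> : win (init 0) 2 (set_nth 0 [:: w; q; 1] 2 0) =
      win (init 0) 2 [:: w; q] by apply: eq_win; nths.
    by apply: ev_eq; [exact: (ev_body _ _ hc) | rewrite h0].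
  by [].
have none : forall f q, run X (search_prog c n) f (size pre) (S q) = None.
  elim/ltn_ind=> {}f IH q; have [k hk] := once q.
  case r: (run _ _ _ _ _) => [r'|] //.
  have [le|lt] := leqP f k.+1; first by have := run_mono le r; rewrite -[k.+1]addn0 hk.
  by move: r; rewrite -(subnKC (ltnW lt)) hk IH //; lia.
have [k hk] := start; case r: (run _ _ _ _ _) => [r'|] //.
by have := run_mono (leq_addl k f) r; rewrite hk none.
Qed.

Lemma search_progP y :
  (exists s r, run X (search_prog c n) s 0 (init x) = Some r /\ r 0 = y) <->
  (exists q, F (pairing w q) = y.+1 /\ forall q', q' < q -> F (pairing w q') = 0).
Proof.
have fwd q : 0 < F (pairing w q) -> (forall q', q' < q -> F (pairing w q') = 0) ->
    exists s r, run X (search_prog c n) s 0 (init x) = Some r /\ r 0 = (F (pairing w q)).-1.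
  move=> hq h0; have [r er r0] := ev_search h0 hq.
  have [k hk] := compileP er (nseq n (Inc 2)) [::].
  exists (n + (k + 1)), r; split=> //.
  have := steps_trans (steps_prefix n _) _ _; rewrite addnA /search_prog.
  rewrite size_nseq cats0 in hk.
  by move/(_ _ _ _ _ hk) ->; rewrite run_S size_cat size_nseq size_compile ltnn.
split=> [[s [r [h <-]]]|[q [e h0]]]; last first.
  have [|s [r [h r0]]] := fwd q _ h0; first by rewrite e.
  by exists s, r; rewrite e in r0.
(* Halting excludes that all values vanish; the least nonvanishing one is then the output, as runs
   are deterministic. *)
have ex : exists q, 0 < F (pairing w q).
  apply: NNPP => nex; have : run X (search_prog c n) s 0 (init x) = None.
    apply: search_none => q; apply/eqP; rewrite -leqn0 leqNgt; apply/negP => p.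
    by apply: nex; exists q.
  by rewrite h.
case: (ex_minnP ex) => q hq mn; exists q.
have h0 q' : q' < q -> F (pairing w q') = 0.
  by move=> lt; apply/eqP; rewrite -leqn0 leqNgt; apply/negP => /mn; rewrite leqNgt lt.
split=> //; have [s' [r' [h' r0]]] := fwd q hq h0.
have := run_mono (leq_maxl s s') h; rewrite (run_mono (leq_maxr s s') h').
by case=> <-; rewrite r0 prednK.
Qed.
End SearchProg.

(** * Codes of compiled programs, and parametrised search *)

Lemma pickle_cons i (p : program) : pickle (i :: p) = (pairing (pickle i) (pickle p)).+1.
Proof. by rewrite -code_cons. Qed.

(** The tail [T] stands for the code that follows the command; it turns the concatenations of
    [compile] into repeated consing on codes. *)
Lemma pr_pickle_compile c k (T : nat -> program) :
  pr1 (fun n => pickle (T n)) -> pr1 (fun n => pickle (compile (n + k) c ++ T n)).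
Proof.
have pr_cons (I : nat -> instr) (P : nat -> program) : pr1 (fun n => pickle (I n)) ->
    pr1 (fun n => pickle (P n)) -> pr1 (fun n => pickle (I n :: P n)).
  move=> pI pP; apply: (pr_ext (pr_S (pr_pair pI pP))) => _ n.
  by rewrite pickle_cons.
have prDec r (J : nat -> nat) : pr1 J -> pr1 (fun n => pickle (Dec r (J n))).
  move=> pJ; apply: (pr_ext (F := fun _ n =>
    (pairing (CodeSeq.code [:: 1; r]) (pairing (J n) 0).+1).+1)).
    by prs; apply: pJ.
  by move=> _ n; rewrite -[pickle _]/(CodeSeq.code [:: CodeSeq.code [:: 1; r]; J n]) !code_cons.
have prc i : pr1 (fun=> pickle i) by apply: pr_const.
elim: c k T => [|r|r|r|a IHa b IHb|r c IH] k T pT /=; try exact: pr_cons.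
- exact: pT.
- by apply: (pr_cons) => //; apply: (prDec); prs.
- apply: (pr_ext (IHa k _ (IHb (k + csize a) _ pT))) => _ n.
  by rewrite addnA catA.
- apply: (pr_cons); first by apply: (prDec); prs.
  have pT' : pr1 (fun n => pickle (Dec 1 (n + k) :: T n)).
    by apply: (pr_cons) => //; apply: (prDec); prs.
  by apply: (pr_ext (IH k.+1 _ pT')) => _ n; rewrite cat_rcons addnS.
Qed.

Lemma pickle_nseq n i (p : program) :
  pickle (nseq n i ++ p) = iter n (fun m => (pairing (pickle i) m).+1) (pickle p).
Proof. by elim: n => //= n <-; rewrite pickle_cons. Qed.

Lemma pr_search_prog c : pr1 (fun n => pickle (search_prog c n)).
Proof.
have := @pr_pickle_compile (CSearch c) 0 (fun=> [::]) (pr_const _) => pc.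
have pc' : pr1 (fun n => pickle (compile n (CSearch c))).
  by apply: (pr_ext pc) => _ n; rewrite addn0 cats0.
have pi (k : nat) : pr (fun _ n => iter n (fun m => (pairing k m).+1)
    (pickle (compile n (CSearch c)))).
  by apply: (pr_iter_gen (h := fun _ _ m => (pairing k m).+1)) => //; prs.
apply: (pr_ext (pi (pickle (Inc 2)))) => _ n.
by rewrite /search_prog pickle_nseq.
Qed.

(* s-m-n and unbounded search in one statement. *)
Theorem pr_search F : pr F -> exists e : nat -> nat, pr1 e /\
  forall n X x y, Phi X (e n) x y <->
    exists q, F X (pairing (pairing n x) q) = y.+1 /\
              forall q', q' < q -> F X (pairing (pairing n x) q') = 0.
Proof.
move=> /pr_cmd [c hc]; exists (fun n => pickle (search_prog c n)).
split; first exact: pr_search_prog.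
move=> n X x y; rewrite /Phi /prog_of pickleK /=.
by apply: (search_progP (F := F X)) => r b z; apply: hc.
Qed.

Lemma pr_computable f : pr1 f -> computable_fun f.
Proof.
move=> pf; have pF : pr (fun _ z => (f (psnd (pfst z))).+1) by prs; apply: (pr_comp pf pr_id).
have [e [_ he]] := pr_search pF; exists (e 0) => n; apply/he; exists 0.
by split=> //; rewrite pfst_pairing psnd_pairing.
Qed.

Lemma pr_search_computable (X : nat -> bool) (F : nat -> nat -> nat) : pr2 F ->
  (forall x, exists q, 0 < F x q) -> (forall x q, 0 < F x q -> F x q = (X x).+1) ->
  computable_set X.
Proof.
move=> pF ex un.
have pF' : pr (fun _ z => F (psnd (pfst z)) (psnd z)) by apply: (pr_app2 pF); prs.
have [e [_ he]] := pr_search pF'; exists (e 0) => x; apply/he.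
case: (ex_minnP (ex x)) => q hq mn; exists q; rewrite !(pfst_pairing, psnd_pairing).
split; first exact: un.
move=> q' lt; rewrite !(pfst_pairing, psnd_pairing); apply/eqP.
by rewrite -leqn0 leqNgt; apply/negP => /mn; rewrite leqNgt lt.
Qed.

(** * The construction *)

(* A string is coded as [u = pairing w c]: its length is [w = pfst u] and its bits
   are those of the finite map [c = psnd u] below [w]. *)
Definition upto (u t : nat) : nat := pairing t (psnd u).

(** A search that fails returns the length [pfst u], here and in the definitions below that use
    bounded search in strings. *)
Definition next_elt (u p r : nat) : nat :=
  find (fun z => [&& r <= z, pfst z == p & bit (psnd u) z]) (iota 0 (pfst u)).

Definition next_gap (u p r : nat) : nat :=
  find (fun z => [&& r <= z, pfst z == p & ~~ bit (psnd u) z]) (iota 0 (pfst u)).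

Definition agree (r c d : nat) : bool :=
  all (fun z => bit c z == bit d z) (iota 0 r).

(** The first marker element [z0] is itself the length of the forced string; the second coordinate
    of [z1] codes its bits. *)
Definition restr_new (u s z0 z1 : nat) : nat :=
  if (z1 < pfst u) && agree (pfst s) (psnd z1) (psnd s)
  then pairing z0 (psnd z1) else pairing (pfst u) 0.

Definition restr_step (u i s : nat) : nat :=
  if next_elt u (3 * i).+1 (pfst s) < pfst u
  then restr_new u s (next_elt u (3 * i).+1 (pfst s))
         (next_elt u (3 * i).+1 (next_elt u (3 * i).+1 (pfst s)).+1)
  else s.

(* [restr u n = pairing r d] when the markers found in [u] in the columns below
   3n force the membership of the numbers below [r] to be given by the bits of [d].
   A marker still to be completed (or a wrong one) blocks everything: r = |u|. *)
Definition restr (u n : nat) : nat :=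
  nat_rect (fun=> nat) (pairing 0 0) (restr_step u) n.

(** The shape that the set has when the n-th counter runs forever: counter column full, marker
    column empty. Columns beyond [(3 * n).+1] are left free. *)
Definition fits (i n u z : nat) : bool :=
  if pfst z < 3 * n then bit (psnd u) z == bit (psnd i) z
  else if pfst z == 3 * n then bit (psnd u) z
  else (pfst z == (3 * n).+1) ==> ~~ bit (psnd u) z.

Definition valid_ext (r i n u : nat) : bool :=
  all (fun z => (r <= z) ==> fits i n u z) (iota 0 (pfst u)).

(* The strings among which the n-th requirement, knowing the string [i], looks for
   a splitting; [h] tabulates the obedient strings. *)
Definition valid (h i n u : nat) : bool :=
  [&& pfst (restr i n) <= pfst u, pfst u < pfst i, pfst (pfst u) == (3 * n).+1,
      pfst u <= psnd u, agree (pfst (restr i n)) (psnd u) (psnd (restr i n)),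
      valid_ext (pfst (restr i n)) i n u & bit h u].

(* q = <<u0, u1>, x>: the strings u0 and u1 give different values at x. *)
Definition splitting (h i n q : nat) : bool :=
  [&& valid h i n (pfst (pfst q)), valid h i n (psnd (pfst q)),
      0 < univ (pfst n) (pfst (pfst q)) (psnd q),
      0 < univ (pfst n) (psnd (pfst q)) (psnd q) &
      univ (pfst n) (pfst (pfst q)) (psnd q) != univ (pfst n) (psnd (pfst q)) (psnd q)].

Definition halts_by (t e : nat) : bool := 0 < univ e (pairing t 0) e.

Definition halting_approx (t : nat) : nat := pairing t (tab (fun e => halts_by t e) t).

Definition choice (t n q : nat) : nat :=
  if univ (pfst n) (pfst (pfst q)) (psnd q) != univ (psnd n) (halting_approx t) (psnd q)
  then pfst (pfst q) else psnd (pfst q).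

Definition first_split (h i n : nat) : nat := find (splitting h i n) (iota 0 (pfst i)).

(* One plus the string that the n-th requirement wants the set to extend, [0] if
   it has found no splitting. *)
Definition target (h i n : nat) : nat :=
  if first_split h i n < pfst i then (choice (pfst i) n (first_split h i n)).+1 else 0.

Definition trunc (h t : nat) : nat := tab (fun k => get k h) t.

Definition enum_counter (h i n : nat) : bool :=
  (target h i n == 0)
  || (target (trunc h (pfst i).-1) (upto i (pfst i).-1) n != target h i n).

Definition enum_marker (h i n z : nat) : bool :=
  [&& next_gap i (3 * n) (pfst (restr i n)) < pfst i, 0 < target h i n &
      (z == pfst (target h i n).-1) || (z == pairing (3 * n).+1 (psnd (target h i n).-1))].

(** A number is at least its second coordinate, so the position chosen lies outside the restraint.
    The value 1 of [univ] stands for the output 0. *)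
Definition enum_diag (i n z : nat) : bool :=
  (psnd z == pfst (restr i n.+1)) && (univ n (pairing (pfst i) 0) z == 1).

(** The number of requirements whose markers bind the column of [z]: column [3n + 2] is bound by the
    marker of [n] itself, columns [3n] and [3n + 1] only by earlier ones. *)
Definition level (z : nat) : nat :=
  if pfst z %% 3 == 2 then (pfst z %/ 3).+1 else pfst z %/ 3.

Definition enumh (h i z : nat) : bool :=
  (z < pfst i) &&
  if z < pfst (restr i (level z)) then bit (psnd (restr i (level z))) z
  else if pfst z %% 3 == 0 then enum_counter h i (pfst z %/ 3)
  else if pfst z %% 3 == 1 then enum_marker h i (pfst z %/ 3) z
  else enum_diag i (pfst z %/ 3) z.

Definition obeys (h u : nat) : bool :=
  all (fun t => all (fun z => enumh (trunc h t) (upto u t) z ==> bit (psnd u) z)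
                    (iota 0 t)) (iota 0 (pfst u).+1).

(** Obedience of [u] involves only stages up to [pfst u <= u], and a stage [t] consults only strings
    with codes below [t]; hence the course-of-values recursion is sound. *)
Definition table (N : nat) : nat :=
  nat_rect (fun=> nat) 0 (fun u h => put h u (obeys h u)) N.

Lemma tableS N : table N.+1 = put (table N) N (obeys (table N) N).
Proof. by []. Qed.

Definition enumerates (i z : nat) : bool := enumh (table (pfst i)) i z.

(** * Primitive recursiveness of the construction *)

Lemma pr_upto : pr2 upto. Proof. by rewrite /upto; prs. Qed.
#[local] Hint Resolve pr_upto : prdb.
Lemma pr_next_elt : pr3 next_elt. Proof. by rewrite /next_elt; prs. Qed.
Lemma pr_next_gap : pr3 next_gap. Proof. by rewrite /next_gap; prs. Qed.
Lemma pr_agree : pr3 agree. Proof. by rewrite /agree; prs. Qed.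
#[local] Hint Resolve pr_next_elt pr_next_gap pr_agree : prdb.
Lemma pr_restr_new : pr4 restr_new. Proof. by rewrite /restr_new; prs. Qed.
#[local] Hint Resolve pr_restr_new : prdb.
Lemma pr_restr_step : pr3 restr_step. Proof. by rewrite /restr_step; prs. Qed.
#[local] Hint Resolve pr_restr_step : prdb.
Lemma pr_restr : pr2 restr. Proof. by rewrite /restr; prs. Qed.
#[local] Hint Resolve pr_restr : prdb.
Lemma pr_fits : pr4 fits. Proof. by rewrite /fits; prs. Qed.
#[local] Hint Resolve pr_fits : prdb.
Lemma pr_valid_ext : pr4 valid_ext. Proof. by rewrite /valid_ext; prs. Qed.
#[local] Hint Resolve pr_valid_ext : prdb.
Lemma pr_valid : pr4 valid. Proof. by rewrite /valid; prs. Qed.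
#[local] Hint Resolve pr_valid : prdb.
Lemma pr_splitting : pr4 splitting. Proof. by rewrite /splitting; prs. Qed.
Lemma pr_halts_by : pr2 halts_by. Proof. by rewrite /halts_by; prs. Qed.
#[local] Hint Resolve pr_splitting pr_halts_by : prdb.
Lemma pr_halting_approx : pr1 halting_approx. Proof. by rewrite /halting_approx; prs. Qed.
#[local] Hint Resolve pr_halting_approx : prdb.
Lemma pr_choice : pr3 choice. Proof. by rewrite /choice; prs. Qed.
Lemma pr_first_split : pr3 first_split. Proof. by rewrite /first_split; prs. Qed.
#[local] Hint Resolve pr_choice pr_first_split : prdb.
Lemma pr_target : pr3 target. Proof. by rewrite /target; prs. Qed.
Lemma pr_trunc : pr2 trunc. Proof. by rewrite /trunc; prs. Qed.
#[local] Hint Resolve pr_target pr_trunc : prdb.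
Lemma pr_enum_counter : pr3 enum_counter. Proof. by rewrite /enum_counter; prs. Qed.
Lemma pr_enum_marker : pr4 enum_marker. Proof. by rewrite /enum_marker; prs. Qed.
Lemma pr_enum_diag : pr3 enum_diag. Proof. by rewrite /enum_diag; prs. Qed.
Lemma pr_level : pr1 level. Proof. by rewrite /level; prs. Qed.
#[local] Hint Resolve pr_enum_counter pr_enum_marker pr_enum_diag pr_level : prdb.
Lemma pr_enumh : pr3 enumh. Proof. by rewrite /enumh; prs. Qed.
#[local] Hint Resolve pr_enumh : prdb.
Lemma pr_obeys : pr2 obeys. Proof. by rewrite /obeys; prs. Qed.
#[local] Hint Resolve pr_obeys : prdb.
Lemma pr_table : pr1 table. Proof. by rewrite /table; prs. Qed.
#[local] Hint Resolve pr_table : prdb.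
Lemma pr_enumerates : pr2 enumerates. Proof. by rewrite /enumerates; prs. Qed.

Opaque upto next_elt next_gap agree restr_new restr_step restr fits
  valid_ext valid splitting halts_by halting_approx choice first_split target trunc
  enum_counter enum_marker enum_diag level enumh obeys table univ.

(** * Verification *)

Definition obedient (u : nat) : bool := obeys (table u) u.

Lemma table_tab N : table N = tab (fun u => obedient u) N.
Proof.
elim: N => [|N IH]; first by [].
rewrite tableS tabS -IH; reflexivity.
Qed.

Lemma bit_table N u : bit (table N) u = (u < N) && obedient u.
Proof. by rewrite table_tab /bit get_tab; case: (u < N); case: (obedient u). Qed.

Transparent trunc.
Lemma trunc_table N t : t <= N -> trunc (table N) t = table t.
Proof.
move=> le; rewrite [table t]table_tab; apply: eq_tab => k lt.
by rewrite table_tab get_tab (leq_trans lt).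
Qed.

Opaque trunc.

Transparent upto.
Lemma pfst_upto u t : pfst (upto u t) = t. Proof. exact: pfst_pairing. Qed.
Lemma psnd_upto u t : psnd (upto u t) = psnd u. Proof. exact: psnd_pairing. Qed.

Opaque upto.

Transparent enumh.
Lemma enumh_lt h i z : enumh h i z -> z < pfst i.
Proof. by case/andP. Qed.

Opaque enumh.

Transparent obeys.
Lemma obedientP u :
  reflect (forall t z, t <= pfst u -> enumerates (upto u t) z -> bit (psnd u) z)
    (obedient u).
Proof.
have e t : t <= pfst u -> trunc (table u) t = table t.
  by move=> le; apply: trunc_table; apply: leq_trans le (pfst_le u).
apply: (iffP allP) => [h t z le|h t].
  have /h/allP : t \in iota 0 (pfst u).+1 by rewrite mem_iota.
  move=> /(_ z); rewrite e // /enumerates pfst_upto => h' ez.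
  have zt : z \in iota 0 t by rewrite mem_iota add0n -(pfst_upto u t) (enumh_lt ez).
  exact: (implyP (h' zt)).
rewrite mem_iota ltnS => le; apply/allP => z _; apply/implyP; rewrite e // => ez.
by apply: (h t z le); rewrite /enumerates pfst_upto; exact: ez.
Qed.

Opaque obeys.

(** * Locality: which columns an enumeration reads *)

Definition same (p i j : nat) := pfst i = pfst j /\
  forall z, z < pfst i -> pfst z < p -> bit (psnd i) z = bit (psnd j) z.

Lemma same_upto p i j t : t <= pfst i -> same p i j -> same p (upto i t) (upto j t).
Proof.
move=> le [e h]; split; first by rewrite !pfst_upto.
by move=> z; rewrite pfst_upto !psnd_upto => zt zp; apply: h => //; apply: leq_trans le.
Qed.

Transparent next_elt next_gap.
Lemma next_elt_same p q i j r : same p i j -> q < p -> next_elt i q r = next_elt j q r.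
Proof.
move=> [e h] lt; rewrite /next_elt -e; apply: eq_in_find => z.
rewrite mem_iota => zi; case: (_ <= z) => //=.
by case: eqP => //= pz; rewrite h // pz.
Qed.

Lemma next_gap_same p q i j r : same p i j -> q < p -> next_gap i q r = next_gap j q r.
Proof.
move=> [e h] lt; rewrite /next_gap -e; apply: eq_in_find => z.
rewrite mem_iota => zi; case: (_ <= z) => //=.
by case: eqP => //= pz; rewrite h // pz.
Qed.

Opaque next_elt next_gap.

Transparent restr_step restr_new.
Lemma restr_step_same p i j k s : same p i j -> (3 * k).+1 < p ->
  restr_step i k s = restr_step j k s.
Proof.
move=> sm lt; rewrite /restr_step /restr_new !(next_elt_same _ sm lt).
by case: sm => ->.
Qed.

Opaque restr_step restr_new.

Transparent restr.
Lemma restrS u n : restr u n.+1 = restr_step u n (restr u n).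
Proof. by []. Qed.

Opaque restr.

(** The columns read are [3k + 1] for [k < n], the last being [3n - 2]; this explains the bound. *)
Lemma restr_same p i j n : same p i j -> 3 * n <= p.+1 -> restr i n = restr j n.
Proof.
move=> sm; elim: n => // n IH le; rewrite !restrS IH; last by lia.
by apply: restr_step_same sm _; lia.
Qed.

Transparent valid valid_ext fits.
Lemma valid_same p h i j n u : same p i j -> 3 * n <= p -> valid h i n u = valid h j n u.
Proof.
move=> sm le; rewrite /valid (restr_same sm); last by lia.
case: sm => e sm; rewrite -e; case: (_ <= pfst u) => //=; case: ltnP => //= lt.
case: (_ == _) => //=; case: (_ <= _) => //=; case: (agree _ _ _) => //=; congr andb.
apply: eq_in_all => z; rewrite mem_iota => zu; congr (_ ==> _).
rewrite /fits; case: ltnP => // lt'.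
by rewrite sm //; [move: zu lt; lia | exact: leq_trans le].
Qed.

Opaque valid valid_ext fits.

Transparent target first_split splitting.
Lemma target_same p h i j n : same p i j -> 3 * n <= p -> target h i n = target h j n.
Proof.
move=> sm le; rewrite /target.
have -> : first_split h i n = first_split h j n.
  case: (sm) => e _; rewrite /first_split -e; apply: eq_find => q.
  by rewrite /splitting !(valid_same _ _ sm le).
by case: sm => ->.
Qed.

Opaque target first_split splitting.

Transparent enumh enum_counter enum_marker enum_diag level.
(** Each kind of column reads strictly smaller columns only: counters read earlier markers, markers
    also their counter, diagonal columns also their marker. This is what makes the set REA. *)
Lemma enumh_same h i j z : same (pfst z) i j -> enumh h i z = enumh h j z.
Proof.
move=> sm; rewrite /enumh /enum_counter /enum_marker /enum_diag.
have [e _] := sm; rewrite -e; case: ltnP => //= zi.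
have dm := divn_eq (pfst z) 3; have lt3 : pfst z %% 3 < 3 by rewrite ltn_mod.
have -> : restr i (level z) = restr j (level z).
  by apply: (restr_same sm); rewrite /level; case: eqP; lia.
have tg h' i' j' : same (pfst z) i' j' ->
    target h' i' (pfst z %/ 3) = target h' j' (pfst z %/ 3).
  by move=> sm'; apply: target_same sm' _; lia.
case: ifP => // _; case: eqP => [m0|n0].
  have tg' := tg (trunc h (pfst i).-1) _ _ (same_upto (leq_pred (pfst i)) sm).
  rewrite (tg h i j sm) tg'; reflexivity.
case: eqP => [m1|n1]; last by rewrite (restr_same sm) //; lia.
rewrite (tg h i j sm) (next_gap_same _ sm); last by lia.
by rewrite (restr_same sm) //; lia.
Qed.
Opaque enumh enum_counter enum_marker enum_diag level.

Lemma enumerates_same i j z : same (pfst z) i j -> enumerates i z = enumerates j z.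
Proof. by move=> sm; rewrite /enumerates (enumh_same _ sm); case: sm => ->. Qed.

(** * Bounded search and initial segments of sets *)

Lemma find_iota_le (P : pred nat) n : find P (iota 0 n) <= n.
Proof. by rewrite -{2}(size_iota 0 n) find_size. Qed.

Lemma find_iotaP (P : pred nat) n : find P (iota 0 n) < n -> P (find P (iota 0 n)).
Proof.
move=> lt; have : has P (iota 0 n) by rewrite has_find size_iota.
by move/(nth_find 0); rewrite nth_iota.
Qed.

Lemma find_iota_min (P : pred nat) n z : P z -> z < n -> find P (iota 0 n) <= z.
Proof.
move=> pz lt; rewrite leqNgt; apply/negP => /(before_find 0).
by rewrite nth_iota // add0n pz.
Qed.

Lemma find_iota_eq (P : pred nat) n k : P k -> k < n -> (forall z, P z -> k <= z) ->
  find P (iota 0 n) = k.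
Proof.
move=> pk lt mn; have le := find_iota_min pk lt; apply/eqP; rewrite eqn_leq le /=.
by apply/mn/find_iotaP/(leq_ltn_trans le).
Qed.

Lemma find_iota_none (P : pred nat) n : (forall z, z < n -> ~~ P z) -> find P (iota 0 n) = n.
Proof.
move=> h; apply/eqP; rewrite eqn_leq find_iota_le leqNgt; apply/negP => lt.
by have := find_iotaP lt; apply/negP/h.
Qed.

Definition str (X : nat -> bool) (t : nat) : nat := pairing t (tab (fun z => X z) t).

Lemma pfst_str X t : pfst (str X t) = t. Proof. exact: pfst_pairing. Qed.

Lemma bit_str X t z : bit (psnd (str X t)) z = (z < t) && X z.
Proof. by rewrite psnd_pairing /bit get_tab; case: (z < t); case: (X z). Qed.

Lemma agreeP r c d : reflect (forall z, z < r -> bit c z = bit d z) (agree r c d).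
Proof.
Transparent agree.
apply: (iffP allP) => h z; last by rewrite mem_iota => zr; apply/eqP; rewrite h.
by move=> zr; have := h z; rewrite mem_iota zr => /(_ isT) /eqP.
Opaque agree.
Qed.

(** * Sets enumerated from their own initial segments *)

Section Construction.
Variable C : nat -> bool.
Hypothesis CE : forall z, C z <-> exists t, enumerates (str C t) z.

Definition rs t n := restr (str C t) n.
Definition tg t n := target (table t) (str C t) n.
Definition gap t n r := next_gap (str C t) (3 * n) r.

Lemma str_upto t s p : s <= t -> same p (upto (str C t) s) (str C s).
Proof.
move=> le; split; first by rewrite pfst_upto pfst_str.
move=> z; rewrite pfst_upto psnd_upto !bit_str => zs _.
by rewrite zs (leq_trans zs le).
Qed.

Lemma enumeratesE t z : enumerates (str C t) z = (z < t) &&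
  if z < pfst (rs t (level z)) then bit (psnd (rs t (level z))) z
  else if pfst z %% 3 == 0 then
    (tg t (pfst z %/ 3) == 0) || (tg t.-1 (pfst z %/ 3) != tg t (pfst z %/ 3))
  else if pfst z %% 3 == 1 then
    [&& gap t (pfst z %/ 3) (pfst (rs t (pfst z %/ 3))) < t, 0 < tg t (pfst z %/ 3) &
      (z == pfst (tg t (pfst z %/ 3)).-1)
      || (z == pairing (3 * (pfst z %/ 3)).+1 (psnd (tg t (pfst z %/ 3)).-1))]
  else (psnd z == pfst (rs t (pfst z %/ 3).+1)) && (univ (pfst z %/ 3) (pairing t 0) z == 1).
Proof.
Transparent enumh enum_counter enum_marker enum_diag.
rewrite /enumerates pfst_str /enumh /enum_counter /enum_marker /enum_diag pfst_str.
have e n : target (trunc (table t) t.-1) (upto (str C t) t.-1) n = tg t.-1 n.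
  rewrite trunc_table ?leq_pred // /tg.
  by apply: (target_same _ (str_upto (3 * n) (leq_pred t))).
by rewrite e.
Opaque enumh enum_counter enum_marker enum_diag.
Qed.

Transparent level.
Lemma level0 z n : pfst z = 3 * n -> [/\ level z = n, pfst z %% 3 = 0 & pfst z %/ 3 = n].
Proof.
move=> e; have [m d] : pfst z %% 3 = 0 /\ pfst z %/ 3 = n by rewrite e; lia.
by rewrite /level m d.
Qed.

Lemma level1 z n : pfst z = (3 * n).+1 ->
  [/\ level z = n, pfst z %% 3 = 1 & pfst z %/ 3 = n].
Proof.
move=> e; have [m d] : pfst z %% 3 = 1 /\ pfst z %/ 3 = n by rewrite e; lia.
by rewrite /level m d.
Qed.

Lemma level2 z n : pfst z = (3 * n).+2 ->
  [/\ level z = n.+1, pfst z %% 3 = 2 & pfst z %/ 3 = n].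
Proof.
move=> e; have [m d] : pfst z %% 3 = 2 /\ pfst z %/ 3 = n by rewrite e; lia.
by rewrite /level m d.
Qed.
Opaque level.

Lemma CP z : C z -> exists t, z < t /\ enumerates (str C t) z.
Proof. by move=> /CE [t et]; exists t; split=> //; have := enumh_lt et; rewrite pfst_str. Qed.

Lemma CI t z : enumerates (str C t) z -> C z.
Proof. by move=> et; apply/CE; exists t. Qed.

Lemma enum_blocked t z : rs t (level z) = pairing t 0 -> enumerates (str C t) z = false.
Proof.
move=> e; rewrite enumeratesE e pfst_pairing psnd_pairing; by case: ltnP.
Qed.

Lemma enum0 t z n R d : pfst z = 3 * n -> R <= z -> z < t -> rs t n = pairing R d ->
  enumerates (str C t) z = (tg t n == 0) || (tg t.-1 n != tg t n).
Proof.
move=> /level0 [l m dv] Rz zt e.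
by rewrite enumeratesE l m dv e pfst_pairing zt ltnNge Rz.
Qed.

Lemma enum1 t z n R d : pfst z = (3 * n).+1 -> R <= z -> z < t ->
  rs t n = pairing R d -> enumerates (str C t) z =
    [&& gap t n R < t, 0 < tg t n &
      (z == pfst (tg t n).-1) || (z == pairing (3 * n).+1 (psnd (tg t n).-1))].
Proof.
move=> /level1 [l m dv] Rz zt e.
by rewrite enumeratesE l m dv e pfst_pairing zt ltnNge Rz.
Qed.

Lemma enum2 t z n R d : pfst z = (3 * n).+2 -> R <= z -> z < t ->
  rs t n.+1 = pairing R d -> enumerates (str C t) z =
    (psnd z == R) && (univ n (pairing t 0) z == 1).
Proof.
move=> /level2 [l m dv] Rz zt e.
by rewrite enumeratesE l m dv e pfst_pairing zt ltnNge Rz.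
Qed.

Definition valid_at t n u := valid (table t) (str C t) n u.
Definition split_at t n q := splitting (table t) (str C t) n q.
Definition fsplit t n := first_split (table t) (str C t) n.

Lemma split_atE t n q : split_at t n q =
  [&& valid_at t n (pfst (pfst q)), valid_at t n (psnd (pfst q)),
      0 < univ (pfst n) (pfst (pfst q)) (psnd q),
      0 < univ (pfst n) (psnd (pfst q)) (psnd q) &
      univ (pfst n) (pfst (pfst q)) (psnd q) != univ (pfst n) (psnd (pfst q)) (psnd q)].
Proof. Transparent splitting. by []. Opaque splitting. Qed.

Lemma fsplitE t n : fsplit t n = find (split_at t n) (iota 0 t).
Proof.
Transparent first_split.
by rewrite /fsplit /first_split pfst_str.
Opaque first_split.
Qed.

Lemma tgE t n : tg t n = if fsplit t n < t then (choice t n (fsplit t n)).+1 else 0.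
Proof.
Transparent target.
by rewrite /tg /target pfst_str.
Opaque target.
Qed.

Lemma choice_or t n q : choice t n q = pfst (pfst q) \/ choice t n q = psnd (pfst q).
Proof.
Transparent choice.
by rewrite /choice; case: ifP; [left|right].
Opaque choice.
Qed.

Lemma valid_atP t n R d u : rs t n = pairing R d ->
  reflect [/\ R <= pfst u, u < t, pfst (pfst u) = (3 * n).+1, pfst u <= psnd u &
    [/\ forall z, z < R -> bit (psnd u) z = bit d z, obedient u &
      forall z, R <= z -> z < pfst u ->
      [/\ pfst z < 3 * n -> bit (psnd u) z = C z,
          pfst z = 3 * n -> bit (psnd u) z &
          pfst z = (3 * n).+1 -> bit (psnd u) z = false]]]
    (valid_at t n u).
Proof.
Transparent valid valid_ext fits.
move=> e; rewrite /valid_at /valid -/(rs t n) e pfst_str pfst_pairing psnd_pairing.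
rewrite bit_table.
have lt' : u < t -> pfst u < t by apply: leq_ltn_trans (pfst_le u).
apply: (iffP and5P) => [[-> _ /eqP -> -> /and3P[/agreeP ag ve /andP[ut ob]]]|].
  have lt := lt' ut; split=> //; split=> // z Rz zu.
  have := allP ve z; rewrite mem_iota zu Rz.
  move=> /(_ isT); rewrite /= /fits bit_str (ltn_trans zu lt) /=.
  case: ltnP => h; first by move=> /eqP ->; split; lia.
  case: eqP => [-> //|ne]; first by move=> ->; split; lia.
  by move=> /implyP h'; split; [lia|lia|move=> pz; apply/negbTE/h'; rewrite pz].
case=> Ru ut pu uc [ag ob h]; have lt := lt' ut.
split=> //; first exact/eqP.
apply/and3P; split; [exact/agreeP| |by rewrite ut].
apply/allP => z; rewrite mem_iota /= add0n => zu; apply/implyP => Rz.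
have [h1 h2 h3] := h z Rz zu; rewrite /fits bit_str (ltn_trans zu lt) /=.
case: ltnP => [/h1 -> //|h4]; case: eqP => // _.
by apply/implyP => /eqP /h3 ->.
Opaque valid valid_ext fits.
Qed.

Lemma tgP t n u : tg t n = u.+1 -> [/\ fsplit t n < t, split_at t n (fsplit t n),
  choice t n (fsplit t n) = u & valid_at t n u].
Proof.
rewrite tgE; case: ltnP => // lt [cu]; have sp : split_at t n (fsplit t n).
  by move: lt; rewrite fsplitE; apply: find_iotaP.
split=> //; move: sp; rewrite split_atE -cu => /and5P[v0 v1 _ _ _].
by case: (choice_or t n (fsplit t n)) => ->.
Qed.

(** A valid string has a code below [t], while a blocking restraint asks for a length of at least
    [t]. *)
Lemma tg_blocked t n : rs t n = pairing t 0 -> tg t n = 0.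
Proof.
move=> e; case h: (tg t n) => [//|u]; have [_ _ _] := tgP h.
case/(valid_atP _ e) => tu ut; have := pfst_le u; lia.
Qed.

(** * Convergence of the restraints and outcomes of the counters *)

Definition final n R d T := forall t,
  (T <= t -> rs t n = pairing R d) /\
  (R < t -> rs t n = pairing R d \/ rs t n = pairing t 0).

Lemma final0 : final 0 0 0 0.
Proof. Transparent restr. by move=> t; split=> // _; left. Opaque restr. Qed.

Lemma rsS t n : rs t n.+1 = restr_step (str C t) n (rs t n).
Proof. exact: restrS. Qed.

Lemma next_eltE t p r : next_elt (str C t) p r =
  find (fun z => [&& r <= z, pfst z == p & bit (psnd (str C t)) z]) (iota 0 t).
Proof. Transparent next_elt. by rewrite /next_elt pfst_str. Opaque next_elt. Qed.

Lemma gapE t n r : gap t n r =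
  find (fun z => [&& r <= z, pfst z == 3 * n & ~~ bit (psnd (str C t)) z]) (iota 0 t).
Proof. Transparent next_gap. by rewrite /gap /next_gap pfst_str. Opaque next_gap. Qed.

Lemma gapP t n r : gap t n r < t ->
  [/\ r <= gap t n r, pfst (gap t n r) = 3 * n & C (gap t n r) = false].
Proof.
rewrite gapE => lt; have /and3P[h1 /eqP h2 h3] := find_iotaP lt.
by split=> //; apply/negbTE; rewrite bit_str lt in h3.
Qed.

Lemma gap_lt t n r z : r <= z -> pfst z = 3 * n -> C z = false -> z < t -> gap t n r <= z.
Proof.
move=> rz pz cz zt; rewrite gapE; apply: find_iota_min => //.
by rewrite rz pz eqxx bit_str cz andbF.
Qed.

Lemma rsS_none t n R d : rs t n = pairing R d ->
  (forall z, R <= z -> z < t -> pfst z = (3 * n).+1 -> C z = false) -> rs t n.+1 = rs t n.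
Proof.
Transparent restr_step.
move=> e h; rewrite rsS /restr_step e pfst_pairing pfst_str.
rewrite {1}next_eltE find_iota_none ?ltnn // => z zt.
rewrite bit_str zt; case: leqP => //= Rz; case: eqP => //= pz.
by rewrite h.
Opaque restr_step.
Qed.

Lemma rsS_blocked t n : rs t n = pairing t 0 -> rs t n.+1 = pairing t 0.
Proof. by move=> e; rewrite (@rsS_none t n t 0) // => z; lia. Qed.

Lemma rsS_marker t n R d w z1 : rs t n = pairing R d -> R <= w -> w < t -> w < z1 ->
  (forall z, R <= z -> pfst z = (3 * n).+1 -> C z = (z == w) || (z == z1)) ->
  pfst w = (3 * n).+1 -> pfst z1 = (3 * n).+1 -> agree R (psnd z1) d ->
  rs t n.+1 = if z1 < t then pairing w (psnd z1) else pairing t 0.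
Proof.
Transparent restr_step restr_new.
move=> e Rw wt wz h pw pz ag.
have cw : C w by rewrite h // eqxx.
have cz : C z1 by rewrite h ?eqxx ?orbT //; lia.
have e1 : next_elt (str C t) (3 * n).+1 R = w.
  rewrite next_eltE; apply: find_iota_eq => //.
    by rewrite Rw pw eqxx bit_str wt cw.
  move=> z /and3P[Rz /eqP pz'].
  by rewrite bit_str => /andP[_]; rewrite h // => /orP[/eqP ->|/eqP ->] //; exact: ltnW.
rewrite rsS /restr_step e pfst_pairing pfst_str e1 wt /restr_new pfst_pairing psnd_pairing.
rewrite pfst_str; case: (ltnP z1 t) => zt.
  have -> : next_elt (str C t) (3 * n).+1 w.+1 = z1; last by rewrite zt ag.
  rewrite next_eltE; apply: find_iota_eq => //.
    by rewrite wz pz eqxx bit_str zt cz.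
  move=> z /and3P[wz' /eqP pz']; rewrite bit_str h //; last by lia.
  by case/andP=> _ /orP[/eqP ?|/eqP ->] //; lia.
rewrite next_eltE find_iota_none ?ltnn // => z zt'.
rewrite bit_str zt'; case: leqP => //= wz'; case: eqP => //= pz'.
by rewrite h //; lia.
Opaque restr_step restr_new.
Qed.

(* [stops]: the n-th counter is finite and its last target u is forced.
   [runs]: above the restraint R the counter is full and the marker column empty. *)
Definition stops n R d u := [/\
  exists z0, forall t, z0 <= t -> tg t n = u.+1,
  [/\ R <= pfst u, pfst (pfst u) = (3 * n).+1, pfst u < pairing (3 * n).+1 (psnd u),
      obedient u & forall z, z < R -> bit (psnd u) z = bit d z],
  forall z, R <= z -> z < pfst u ->
    [/\ pfst z < 3 * n -> bit (psnd u) z = C z,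
        pfst z = 3 * n -> bit (psnd u) z /\ C z &
        pfst z = (3 * n).+1 -> bit (psnd u) z = false],
  exists B, forall z, B <= z -> pfst z = 3 * n -> C z = false &
  forall z, R <= z -> pfst z = (3 * n).+1 ->
    C z = (z == pfst u) || (z == pairing (3 * n).+1 (psnd u))].

Definition runs n R := [/\
  forall z, R <= z -> pfst z = 3 * n -> C z &
  forall z, R <= z -> pfst z = (3 * n).+1 -> C z = false].

(** The purpose of the second clause of [final]: past [R] a restraint that is not the final one
    blocks, and a blocked level enumerates nothing. *)
Lemma final_nonblocked n R d T t z : final n R d T -> R <= z -> z < t ->
  enumerates (str C t) z -> level z = n -> rs t n = pairing R d.
Proof.
move=> fin Rz zt et lz; have [_ /(_ (leq_ltn_trans Rz zt)) []] // := fin t.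
by move=> e; rewrite enum_blocked ?lz in et.
Qed.

Lemma marker_elim n R d T t z : final n R d T -> R <= z -> z < t -> pfst z = (3 * n).+1 ->
  enumerates (str C t) z -> [/\ rs t n = pairing R d, gap t n R < t &
    exists u, tg t n = u.+1 /\ ((z == pfst u) || (z == pairing (3 * n).+1 (psnd u)))].
Proof.
move=> fin Rz zt pz et; have [lz _ _] := level1 pz.
have e := final_nonblocked fin Rz zt et lz.
move: et; rewrite (enum1 pz Rz zt e) => /and3P[gt tp zu].
by split=> //; exists (tg t n).-1; rewrite prednK.
Qed.

(** A marker element is enumerated only at a stage that sees a gap of the counter column of the set
    itself, above [R]. *)
Lemma final_runs n R d T : final n R d T -> (forall z, R <= z -> pfst z = 3 * n -> C z) ->
  runs n R /\ final n.+1 R d T.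
Proof.
move=> fin full; have mk z : R <= z -> pfst z = (3 * n).+1 -> C z = false.
  move=> Rz pz; apply/negP => /CP [t [zt et]].
  have [_ /gapP [Rg pg cg] _] := marker_elim fin Rz zt pz et.
  by have := full _ Rg pg; rewrite cg.
split; first by split.
move=> t; have [h1 h2] := fin t; split=> [Tt|Rt].
  by rewrite (@rsS_none t n R d) ?h1 // => z Rz _; apply: mk.
case: (h2 Rt) => e; [left|right; exact: rsS_blocked].
by rewrite (@rsS_none t n R d) // => z Rz _; apply: mk.
Qed.

(** As the least gap [z0] is never enumerated, every unblocked stage past it has a nonzero target
    equal to the preceding one. *)
Lemma final_stops n R d T z0 : final n R d T -> R <= z0 -> pfst z0 = 3 * n ->
  C z0 = false -> (forall z, R <= z -> pfst z = 3 * n -> C z = false -> z0 <= z) ->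
  exists u, stops n R d u /\ exists T', final n.+1 (pfst u) (psnd u) T'.
Proof.
move=> fin Rz pz cz mn; have [lz _ _] := level0 pz.
have step t : z0 < t -> rs t n = pairing R d -> 0 < tg t n /\ tg t.-1 n = tg t n.
  move=> zt e; have : enumerates (str C t) z0 = false.
    by apply/negP => /CI; rewrite cz.
  rewrite (enum0 pz Rz zt e) => /norP[].
  by rewrite -lt0n => h /negPn/eqP.
have nb t : z0 < t -> 0 < tg t n -> rs t n = pairing R d.
  move=> zt h; have [_ /(_ (leq_ltn_trans Rz zt)) []] // := fin t.
  by move/tg_blocked => e; rewrite e in h.
(* Downward induction from a stage past [T]: the target is nonzero there and unchanged one stage
   earlier, so that the earlier stage cannot be blocked either. *)
have P t : z0 < t -> rs t n = pairing R d.
  move=> zt; have [/(_ (leq_addl t T)) + _] := fin (t + T).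
  elim: T {fin} => [|T IH]; first by rewrite addn0.
  rewrite addnS => h; apply: IH; apply: nb; first by rewrite ltn_addr.
  by have [|h1 /= ->] := step _ _ h; first by rewrite ltnS ltnW // ltn_addr.
have tgc t : z0 <= t -> tg t n = tg z0 n.
  elim: t => [|t IH]; first by rewrite leqn0 => /eqP ->.
  rewrite leq_eqVlt => /orP[/eqP -> //|zt].
  by have [_ /= <-] := step _ zt (P _ zt); apply: IH.
case h: (tg z0 n) => [|u].
  by have [] := step z0.+1 (ltnSn _) (P _ (ltnSn _)); rewrite tgc // h.
exists u.
have /tgP [_ _ _] : tg z0.+1 n = u.+1 by rewrite tgc.
case/(valid_atP _ (P _ (ltnSn _))) => Ru ut pu uc [ag ob bits].
(* Validity at stage [z0.+1] gives [pfst u <= z0], and the two lie in different columns. *)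
have uz : pfst u < z0.
  rewrite ltn_neqAle; apply/andP; split.
    by apply/eqP => e; move: pu; rewrite e pz; lia.
  by rewrite -ltnS (leq_ltn_trans _ ut) // pfst_le.
have uz1 : pfst u < pairing (3 * n).+1 (psnd u).
  by rewrite pairingSl ltnS; have := pairing_ger (3 * n) (psnd u); lia.
have full z : R <= z -> z < z0 -> pfst z = 3 * n -> C z.
  by move=> Rz' zz pz'; case c: (C z) => //; have := mn _ Rz' pz' c; lia.
(* A marker is enumerated only at a stage beyond some gap, hence beyond [z0], where the target is
   already [u]. *)
have mk z : R <= z -> pfst z = (3 * n).+1 ->
    C z = (z == pfst u) || (z == pairing (3 * n).+1 (psnd u)).
  move=> Rz' pz'; apply/idP/idP.
    case/CP=> t [zt et]; have [_ gt [u' [e' zu]]] := marker_elim fin Rz' zt pz' et.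
    have [g1 g2 g3] := gapP gt; have le := mn _ g1 g2 g3.
    move: e'; rewrite tgc ?h; last exact: leq_trans le (ltnW gt).
    by case=> ->.
  move=> zu; apply: (@CI (z + z0).+1).
  have lt : z0 < (z + z0).+1 by rewrite ltnS leq_addl.
  rewrite (enum1 pz' Rz' _ (P _ lt)) ?ltnS ?leq_addr //.
  by rewrite tgc ?h // ?zu ?andbT; [apply: leq_ltn_trans (gap_lt Rz pz cz lt) lt|lia].
split; first split=> //; first by exists z0 => t zt; rewrite tgc.
- move=> z Rz' zu; have [b1 b2 b3] := bits z Rz' zu; split=> // e; split; first exact: b2.
  by apply: full => //; apply: ltn_trans uz.
- exists z0.+1 => z zz pz'; apply/negP => /CP [t [zt et]].
  have Rz' : R <= z by lia.
  have z0t : z0 < t by lia.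
  move: et; rewrite (enum0 pz' Rz' zt (P _ z0t)) !tgc ?h ?eqxx //; lia.
(* With only the first of the two marker elements in sight the restraint blocks; with both it has
   its final value. *)
have ru t : R < t -> pfst u < t -> rs t n = pairing R d -> rs t n.+1 =
    if pairing (3 * n).+1 (psnd u) < t then pairing (pfst u) (psnd u) else pairing t 0.
  move=> _ ut' e; rewrite (rsS_marker e Ru ut' uz1 mk) ?psnd_pairing ?pfst_pairing //.
  exact/agreeP.
exists (z0 + T + pairing (3 * n).+1 (psnd u)).+1 => t; split=> [le|ut'].
  have e : rs t n = pairing R d by apply: P; lia.
  by rewrite ru //; [rewrite ifT //; lia|lia|lia].
have Rt : R < t by apply: leq_ltn_trans ut'.
have [_ /(_ Rt) [e|e]] := fin t; last by right; apply: rsS_blocked.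
by rewrite ru //; case: ifP; [left|right].
Qed.

Lemma final_step n R d T : final n R d T ->
  (exists u, stops n R d u /\ exists T', final n.+1 (pfst u) (psnd u) T')
  \/ (runs n R /\ final n.+1 R d T).
Proof.
move=> fin; case: (classic (exists z, [&& R <= z, pfst z == 3 * n & ~~ C z])) => [ex|nex].
  left; case: (ex_minnP ex) => z0 /and3P[Rz /eqP pz /negbTE cz] mn.
  apply: (final_stops fin Rz pz cz) => z Rz' pz' cz'.
  by apply: mn; rewrite Rz' pz' cz' eqxx.
right; apply: final_runs => // z Rz pz; apply/negPn/negP => cz.
by apply: nex; exists z; rewrite Rz pz eqxx cz.
Qed.

Lemma final_ex n : exists R d T, final n R d T.
Proof.
elim: n => [|n [R [d [T /final_step [[u [_ [T' h]]]|[_ h]]]]]].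
- by exists 0, 0, 0; apply: final0.
- by exists (pfst u), (psnd u), T'.
- by exists R, d, T.
Qed.

Lemma final_uniq n R d T R' d' T' : final n R d T -> final n R' d' T' -> R = R' /\ d = d'.
Proof.
move=> /(_ (T + T')) [h _] /(_ (T + T')) [h' _].
have : pairing R d = pairing R' d' by rewrite -h ?leq_addr // h' ?leq_addl.
by move=> e; split; [rewrite -(pfst_pairing R d) e pfst_pairing
  | rewrite -(psnd_pairing R d) e psnd_pairing].
Qed.

Lemma agree_refl r c : agree r c c.
Proof. by apply/agreeP. Qed.

Lemma agree_trans r r' c d e : r <= r' -> agree r' c d -> agree r d e -> agree r c e.
Proof.
move=> le /agreeP h /agreeP h'; apply/agreeP => z zr.
by rewrite h ?h' //; apply: leq_trans le.
Qed.

(* Later markers are only taken into account when they respect earlier ones. *)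
Lemma restr_forced n R d T t k : final n R d T -> R < t -> n <= k ->
  rs t k = pairing t 0 \/ (R <= pfst (rs t k) /\ agree R (psnd (rs t k)) d).
Proof.
Transparent restr_step restr_new.
move=> fin Rt /subnKC <-; elim: (k - n) => [|m IH] {k}.
  rewrite addn0; have [_ /(_ Rt) [->|->]] := fin t; last by left.
  by right; rewrite pfst_pairing psnd_pairing agree_refl.
rewrite addnS; case: IH => [/rsS_blocked|[le ag]]; first by left.
rewrite rsS /restr_step pfst_str; case: ifP => [|_]; last by right.
rewrite {1}next_eltE => /find_iotaP /and3P[h1 _ _].
rewrite /restr_new pfst_str; case: ifP => [/andP[_ ag']|_]; last by left.
right; rewrite pfst_pairing psnd_pairing; split; last exact: agree_trans le ag' ag.
by apply: leq_trans le _; rewrite next_eltE.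
Opaque restr_step restr_new.
Qed.

Lemma level_gt z n : (3 * n).+1 < pfst z -> n < level z.
Proof.
Transparent level.
by rewrite /level; case: eqP; lia.
Opaque level.
Qed.

(** Up to column [3n + 1] the clauses of [stops] settle the matter; the later columns go by
    induction on the column, using obedience of [u] before its length and the restraint after it. *)
Lemma stops_exact n R d T u T' : final n R d T -> stops n R d u ->
  final n.+1 (pfst u) (psnd u) T' ->
  (forall z, z < R -> C z = bit d z) -> forall z, z < pfst u -> C z = bit (psnd u) z.
Proof.
move=> fin [_ [Ru pu uz1 ob low] bits _ mk] fin' IHn z.
move e: (pfst z) => p; elim/ltn_ind: p z e => p IH z pz zu.
have [zR|Rz] := ltnP z R; first by rewrite low // IHn.
have [b1 b2 b3] := bits z Rz zu; have [lt|ge] := ltnP (pfst z) (3 * n); first by rewrite b1.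
have [e0|n0] := eqVneq (pfst z) (3 * n); first by have [-> ->] := b2 e0.
have [e1|n1] := eqVneq (pfst z) (3 * n).+1.
  by rewrite b3 // mk // !ltn_eqF // (ltn_trans zu).
have lz : n < level z by apply: level_gt; lia.
apply/idP/idP => [/CP [t [zt et]]|bz]; last first.
  (* If [u] contains [z], the final restraint at the level of [z] respects [u] and puts [z] in at
     any late stage. *)
  have [R' [d' [T2 fin2]]] := final_ex (level z).
  set t := (R' + T2 + pfst u).+1.
  have e : rs t (level z) = pairing R' d' by have [-> //] := fin2 t; rewrite /t; lia.
  have ut : pfst u < t by rewrite /t; lia.
  case: (restr_forced fin' ut lz) => [e'|].
    have := congr1 pfst e'; rewrite e !pfst_pairing /t; lia.
  rewrite e pfst_pairing psnd_pairing => -[le /agreeP ag].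
  apply: (@CI t); rewrite enumeratesE e pfst_pairing psnd_pairing (leq_trans zu le) ag //.
  by rewrite bz andbT; lia.
(* Up to its length [u] agrees with the set on the lower columns, so the stage enumerates the same
   from [u]. Later stages are blocked or forced to copy [u]. *)
have [tu|ut] := leqP t (pfst u).
  apply: (obedientP _ ob t z tu); rewrite -(enumerates_same (i := str C t)) //.
  split; first by rewrite pfst_upto pfst_str.
  move=> y; rewrite pfst_str psnd_upto bit_str => yt py.
  by rewrite yt (IH (pfst y)) // -?pz //; apply: leq_trans tu.
case: (restr_forced fin' ut lz) => [e'|[le /agreeP ag]].
  by move: et; rewrite enum_blocked.
by move: et; rewrite enumeratesE zt (leq_trans zu le) ag.
Qed.

Lemma exact n R d T : final n R d T -> forall z, z < R -> C z = bit d z.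
Proof.
elim: n R d T => [|n IH] R d T fin.
  by have [-> _] := final_uniq fin final0.
have [R' [d' [T' fin']]] := final_ex n.
case: (final_step fin') => [[u [st [T2 fin2]]]|[_ fin2]].
  have [-> ->] := final_uniq fin fin2.
  exact: (stops_exact fin' st fin2 (IH _ _ _ fin')).
by have [-> ->] := final_uniq fin fin2; apply: IH fin'.
Qed.

(** * Noncomputability *)

Lemma agrees_pairing0 t : agrees empty_set (pairing t 0).
Proof. by move=> z _; rewrite psnd_pairing. Qed.

Lemma univ0_complete e x y : Phi empty_set e x y ->
  exists T, forall t, T <= t -> univ e (pairing t 0) x = y.+1.
Proof.
case/univ_complete => v h; exists v => t le.
by apply: h => [|z _]; rewrite ?pfst_pairing // psnd_pairing.
Qed.

Lemma noncomputable : ~ computable_set C.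
Proof.
move=> [e he]; have [R [d [T fin]]] := final_ex e.+1.
(* The diagonal position for machine [e], taken with the final restraint at level [e.+1]. *)
set z := pairing (3 * e).+2 R.
have pz : pfst z = (3 * e).+2 by rewrite pfst_pairing.
have sz : psnd z = R by rewrite psnd_pairing.
have Rz : R <= z by rewrite -sz psnd_leq.
have := he z; case cz: (C z) => hz.
  have [t [zt et]] := CP cz; have [lz _ _] := level2 pz.
  have er : rs t e.+1 = pairing R d by apply: (final_nonblocked fin Rz zt et lz).
  move: et; rewrite (enum2 pz Rz zt er) => /andP[_ /eqP /univ_sound].
  by move=> /(_ _ (@agrees_pairing0 t)) h; have := Phi_inj h hz.
have [T' h] := univ0_complete hz.
suff : C z by rewrite cz.
apply: (@CI (z + T + T').+1); rewrite (enum2 pz Rz _ (R := R) (d := d)).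
- by rewrite sz eqxx h //; lia.
- by lia.
- by have [-> //] := fin (z + T + T').+1; lia.
Qed.

(** * Computability of finitely many columns *)

Lemma eventually_constant p : exists B b, forall z, B <= z -> pfst z = p -> C z = b.
Proof.
have [R [d [T fin]]] := final_ex (p %/ 3).
have [R' [d' [T' fin']]] := final_ex (p %/ 3).+1.
have dm := divn_eq p 3; have lt3 : p %% 3 < 3 by rewrite ltn_mod.
move: (p %/ 3) fin fin' dm => n fin fin' dm.
have [p2|p2] := eqVneq p (3 * n).+2.
  (* Above the restraint the only candidate of a diagonal column is the element with second
     coordinate [R']. *)
  exists (pairing p R').+1, false => z zB pz; apply/negP => /CP [t [zt et]].
  rewrite p2 in pz; have [lz _ _] := level2 pz.
  have Rz : R' <= z.
    by apply: leq_trans (ltnW zB); rewrite -{1}(psnd_pairing p R') psnd_leq.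
  have e := final_nonblocked fin' Rz zt et lz.
  move: et; rewrite (enum2 pz Rz zt e) => /andP[/eqP sz _].
  by move: zB; rewrite -sz p2 -pz pairing_eta ltnn.
case: (final_step fin) => [[u [[_ [Ru pu uz _ _] _ [B hB] mk] _]]|[[full mk] _]].
  have [p0|p0] := eqVneq p (3 * n).
    by exists B, false => z zB pz; apply: hB; rewrite // pz.
  have p1 : p = (3 * n).+1 by lia.
  exists (pairing (3 * n).+1 (psnd u)).+1, false => z zB pz.
  rewrite mk; [apply/negbTE; lia | lia | by rewrite pz].
have [p0|p0] := eqVneq p (3 * n).
  by exists R, true => z zB pz; apply: full; rewrite // pz.
by exists R, false => z zB pz; apply: mk => //; lia.
Qed.

(** Each of the finitely many columns differs from a constant on a finite set, which is hard-wired
    as a table; no uniformity in [p] is claimed. *)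
Lemma pr_below p : pr1 (fun z => below C p z).
Proof.
elim: p => [|p IH]; first by apply: (pr_ext pr_zero) => _ z.
have [B [b hb]] := eventually_constant p.
have [c hc] : exists c, forall z, z < B -> get z c = C z.
  by exists (tab (fun i => C i) B) => z zB; rewrite get_tab zB.
apply: (pr_ext (F := fun _ z => if pfst z == p then
    (if z < B then get z c else nat_of_bool b) else nat_of_bool (below C p z))).
  by prs; apply: IH.
move=> _ z; rewrite /below; case: (pfst z =P p) => pz.
  by rewrite pz ltnSn; case: (ltnP z B) => h; [rewrite hc | rewrite (hb z h)].
by rewrite ltnS (leq_eqVlt (pfst z)); case: eqP.
Qed.

(** Once the restraint is final, validity depends on the stage only through [u < t]. *)
Lemma valid_stable n R d T t t' u : final n R d T -> T <= t -> T <= t' ->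
  u < t -> u < t' -> valid_at t n u -> valid_at t' n u.
Proof.
move=> fin Tt Tt' ut ut'.
have [/(_ Tt) e _] := fin t; have [/(_ Tt') e' _] := fin t'.
by move/(valid_atP _ e) => [h1 h2 h3 h4 h5]; apply/(valid_atP _ e').
Qed.

Lemma split_stable n R d T t t' q : final n R d T -> T <= t -> T <= t' ->
  q < t -> q < t' -> split_at t n q = split_at t' n q.
Proof.
have vs s s' u : final n R d T -> T <= s -> T <= s' -> u < s -> u < s' ->
    valid_at s n u = valid_at s' n u.
  by move=> *; apply/idP/idP; apply: valid_stable; eauto.
have c0 : pfst (pfst q) <= q := leq_trans (pfst_le _) (pfst_le _).
have c1 : psnd (pfst q) <= q := leq_trans (psnd_leq _) (pfst_le _).
move=> fin Tt Tt' qt qt'; rewrite !split_atE.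
by rewrite !(vs t t' _ fin) // ?(leq_ltn_trans c0) ?(leq_ltn_trans c1).
Qed.

Lemma fsplit_stable n R d T t t' : final n R d T -> T <= t -> t <= t' ->
  fsplit t n < t -> fsplit t' n = fsplit t n.
Proof.
move=> fin Tt tt'; rewrite [fsplit t n]fsplitE; set q := find _ _ => qt.
have sq := find_iotaP qt; rewrite -/q in sq.
have Tt' := leq_trans Tt tt'; have qt' := leq_trans qt tt'.
have sq' : split_at t' n q by rewrite -(split_stable fin Tt Tt' qt qt').
rewrite fsplitE; apply/eqP; rewrite eqn_leq find_iota_min //=.
have h1 := find_iota_min sq' qt'; have h2 := leq_ltn_trans h1 qt.
have h3 := leq_trans h2 tt'.
apply: find_iota_min; last exact: h2.
rewrite (split_stable fin Tt Tt' h2 h3).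
exact: find_iotaP h3.
Qed.

End Construction.

(** * Approximating the halting set *)

Lemma halts_byP e : exists T, forall t, T <= t -> halts_by t e = halting_set e.
Proof.
Transparent halts_by.
rewrite /halting_set; case: excluded_middle_informative => [w|nw].
  by have [y /univ0_complete [T h]] := w; exists T => t /h; rewrite /halts_by => ->.
exists 0 => t _; rewrite /halts_by; case u: (univ _ _ _) => [|y] //.
case: nw; exists y; apply: univ_sound u.
exact: agrees_pairing0.
Opaque halts_by.
Qed.

(** A halting computation has a finite use, below which the approximation is eventually correct. *)
Lemma halting_approx_complete b x y : Phi halting_set b x y ->
  exists T, forall t, T <= t -> univ b (halting_approx t) x = y.+1.
Proof.
Transparent halting_approx.
case/univ_complete => v h.
have [T hT] : exists T, forall t, T <= t -> forall z, z < v -> halts_by t z = halting_set z.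
  elim: v {h} => [|v [T hT]]; first by exists 0.
  have [T' hT'] := halts_byP v; exists (T + T') => t le z; rewrite ltnS leq_eqVlt.
  case/orP=> [/eqP ->|]; first by apply: hT'; lia.
  by apply: hT; lia.
exists (T + v) => t le; apply: h => [|z zv]; rewrite /halting_approx ?pfst_pairing; first by lia.
rewrite psnd_pairing /bit get_tab ifT; last by lia.
by rewrite hT //; [case: (halting_set z) | lia].
Opaque halting_approx.
Qed.

(** * The minimal pair requirements *)

Section MinimalPair.
Variables (C X : nat -> bool) (a b : nat).
Hypothesis CE : forall z, C z <-> exists t, enumerates (str C t) z.
Hypothesis XC : forall x, Phi C a x (X x).
Hypothesis XH : forall x, Phi halting_set b x (X x).
Let n := pairing a b.
Let an : pfst n = a. Proof. exact: pfst_pairing. Qed.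
Let bn : psnd n = b. Proof. exact: psnd_pairing. Qed.

(* A splitting, once found, is used forever; as the approximation to the second
   functional converges, the target settles on a string giving the other value. *)
Lemma no_split R d T t : final C n R d T -> T <= t -> fsplit C t n = t.
Proof.
Transparent choice.
move=> fin Tt; apply/eqP; rewrite eqn_leq {1}fsplitE find_iota_le leqNgt.
apply/negP => qt; set q := fsplit C t n in qt.
have st s : t <= s -> fsplit C s n = q by move=> ts; apply: (fsplit_stable fin Tt ts qt).
have [T' hT'] := halting_approx_complete (XH (psnd q)).
set u := choice (t + T') n q.
have ux : 0 < univ a u (psnd q) /\ univ a u (psnd q) <> (X (psnd q)).+1.
  have : split_at C t n q by move: (qt); rewrite /q fsplitE; apply: find_iotaP.
  rewrite split_atE an => /and5P[_ _ p0 p1 /eqP ne].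
  (* If the first string gives the value of [X], the second does not, because they split. *)
  rewrite /u /choice an bn hT' ?leq_addl //; case: eqP => /= [e|ne'] //.
  by split=> // e'; apply: ne; rewrite e e'.
have tgu s : t + T' <= s -> tg C s n = u.+1.
  move=> le; rewrite tgE (st s); last by lia.
  rewrite (leq_trans qt); last by lia.
  by rewrite /u /choice bn !hT' ?leq_addl //; lia.
(* If the counter stops, its last target is [u]; the set then extends [u], whose wrong value would
   be the value of the functional on the set. *)
case: (final_step CE fin) => [[u' [[[z0 hz0] [_ _ _ ob _] _ _ _] [T2 fin2]]]|[[full _] _]].
  have eu : u' = u.
    by apply: succn_inj; rewrite -(hz0 (z0 + (t + T'))) ?leq_addr // tgu ?leq_addl.
  have ag := exact CE fin2; rewrite eu in ag; case: ux.
  case h: (univ a u (psnd q)) => [//|y] _ ne; apply: ne; congr _.+1.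
  by apply: Phi_inj (XC _); apply: univ_sound h => z zu; rewrite ag.
(* If the counter runs, this element must enter, but only at a stage where the target is nonzero and
   has stopped changing; such a stage enumerates nothing into the counter. *)
set z := pairing (3 * n) (R + t + T').
have zl : R + t + T' <= z by rewrite -[X in X <= _](psnd_pairing (3 * n)) psnd_leq.
have pz : pfst z = 3 * n by rewrite pfst_pairing.
have Rz : R <= z by lia.
have /(CP CE) [s [zs es]] := full z Rz pz.
have e : rs C s n = pairing R d by have [-> //] := fin s; lia.
by move: es; rewrite (enum0 pz Rz zs e) !tgu ?eqxx //; lia.
Opaque choice.
Qed.

Lemma minimal_pair : computable_set X.
Proof.
have [R [d [T fin]]] := final_ex CE n.
have tg0 t : T <= t -> tg C t n = 0 by move=> Tt; rewrite tgE (no_split fin Tt) ltnn.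
case: (final_step CE fin) => [[u [[[z0 /(_ (z0 + T))]]]]|[[full empty] _]].
  by rewrite leq_addr tg0 ?leq_addl // => /(_ isT).
have low := exact CE fin.
(* Validity reads only the first [3n] columns of the set, which are primitive recursive. The stage
   is past [T] and exceeds the code [u]. *)
pose F x u := if valid (table (T + u).+1) (str (below C (3 * n)) (T + u).+1) n u
  then univ a u x else 0.
have FE x u : F x u = if valid_at C (T + u).+1 n u then univ a u x else 0.
  rewrite /F /valid_at (@valid_same (3 * n) _ _ (str C (T + u).+1)) //.
  split=> [|z _ zn]; rewrite ?pfst_str // !bit_str /below zn.
  by [].
have good x : exists u, univ a u x = (X x).+1 /\
    forall t, T <= t -> u < t -> valid_at C t n u.
  have [v hv] := univ_complete (XC x).
  (* The length of a valid string lies in the marker column; this one also reaches the restraint and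
     the use. *)
  set w := pairing (3 * n).+1 (R + v).
  have wl : R + v <= w by rewrite -[X in X <= _](psnd_pairing (3 * n).+1) psnd_leq.
  (* The extra entry at key [w] is invisible below the length [w] and serves only to make the code
     of the bits large enough. *)
  set c := put (tab (fun z => C z) w) w 1; set u := pairing w c.
  have bc z : z < w -> bit c z = C z.
    by move=> zw; rewrite /bit get_put gtn_eqF // get_tab zw; case: (C z).
  have pu : pfst u = w by rewrite pfst_pairing.
  have su : psnd u = c by rewrite psnd_pairing.
  exists u; split=> [|t Tt ut].
    by apply: hv; rewrite ?pu ?su; [lia | move=> z zv; apply: bc; lia].
  have e : rs C t n = pairing R d by have [-> //] := fin t.
  apply/(valid_atP _ e); rewrite pu su; split=> //; first by lia.
  - exact: pfst_pairing.
  - exact: ltnW (put_gtk _ _ _).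
  split.
  - by move=> z zR; rewrite bc ?low //; lia.
  - apply/obedientP => s z; rewrite pu => sw ez; rewrite su.
    have zs : z < s by rewrite -(pfst_upto u s); apply: enumh_lt ez.
    rewrite bc; last exact: leq_trans sw.
    apply: (CI CE (t := s)); rewrite -(enumerates_same (i := upto u s)) //.
    split=> [|y]; first by rewrite pfst_upto pfst_str.
    rewrite pfst_upto psnd_upto su bit_str => ys _.
    by rewrite ys bc //; apply: leq_trans sw.
  - move=> z Rz zw; rewrite bc //; split=> // pz; first exact: full.
    exact: empty.
apply: (@pr_search_computable X F).
- have := pr_below CE (3 * n); rewrite /F /str; move: (below C _) => D pD.
  by prs.
- move=> x; have [u [ux vu]] := good x.
  by exists u; rewrite FE vu ?ux //; lia.
- move=> x u; rewrite FE; case: ifP => // vu; case ux: (univ a u x) => [//|y] _.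
  have [u' [ux' vu']] := good x; congr _.+1; apply/eqP/negPn/negP => ne.
  (* A wrong value would make [u] and the correct string [u'] a splitting seen at stage [t], against
     [no_split]. *)
  set q := pairing (pairing u u') x; set t := T + q.+1.
  have uq : u <= q by apply: leq_trans (pairing_gel _ _) (pairing_gel _ _).
  have uq' : u' <= q.
    apply: leq_trans (pairing_gel _ x); apply: leq_trans (pairing_ger u u').
    by rewrite -addnn leq_addr.
  have sq : split_at C t n q.
    rewrite split_atE an /q !(pfst_pairing, psnd_pairing) ux ux' eqSS ne.
    rewrite vu' ?andbT //; try by rewrite /t; lia.
    by apply: (valid_stable fin _ _ _ _ vu); rewrite /t; lia.
  have := no_split fin (leq_addr q.+1 T); rewrite -/t fsplitE => e.
  by have := find_iota_min sq (n := t); rewrite e /t; lia.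
Qed.
End MinimalPair.

(** * The set, built column by column *)

Definition decide (A : Prop) : bool := if excluded_middle_informative A then true else false.

Lemma decideP (A : Prop) : decide A <-> A.
Proof. by rewrite /decide; case: excluded_middle_informative. Qed.

(** Column [q] is read off, by excluded middle, from the columns below it; by locality these give
    the same enumerations into it as the whole set. *)
Fixpoint columns (p : nat) : nat -> bool :=
  if p is q.+1 then fun z => if pfst z == q
    then decide (exists t, enumerates (str (columns q) t) z) else columns q z
  else fun _ => false.

Definition rea_set (z : nat) : bool := columns (pfst z).+1 z.

Lemma columnsE p z : columns p z = below rea_set p z.
Proof.
rewrite /below; elim: p => [|p IH] //; rewrite ltnS leq_eqVlt.
case: (pfst z =P p) => [pz|ne] /=; last by case: eqP.
by rewrite /rea_set pz /= pz eqxx.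
Qed.

Lemma same_below X p t : same p (str X t) (str (below X p) t).
Proof.
split=> [|z _ zp]; first by rewrite !pfst_str.
by rewrite !bit_str /below zp.
Qed.

Lemma rea_setE z : rea_set z <-> exists t, enumerates (str rea_set t) z.
Proof.
rewrite {1}/rea_set /= eqxx; apply: iff_trans (decideP _) _.
have e t : enumerates (str (columns (pfst z)) t) z = enumerates (str rea_set t) z.
  rewrite (enumerates_same (same_below rea_set (pfst z) t)); congr enumerates.
  by congr str; apply: functional_extensionality => y; rewrite columnsE.
by split=> -[t h]; exists t; move: h; rewrite (e t).
Qed.

Lemma REA_rea_set : REA_omega rea_set.
Proof.
(* The search runs over stages, with the oracle entering through its initial segments; locality lets
   [below rea_set n] replace the whole set. *)
have pF : pr (fun X z => enumerates (str X (psnd z)) (pairing (pfst (pfst z)) (psnd (pfst z)))).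
  have := pr_enumerates; rewrite /str => pe; prs.
have [f [pf hf]] := pr_search pF; exists f; split; first exact: pr_computable.
move=> n y; rewrite /column rea_setE.
have e t : enumerates (str (below rea_set n) t) (pairing n y) =
    enumerates (str rea_set t) (pairing n y).
  symmetry; apply: enumerates_same; rewrite -[X in below _ X](pfst_pairing n y).
  exact: same_below.
split=> [[t h]|[v /hf [q [h _]]]]; last first.
  exists q; move: h; rewrite !(pfst_pairing, psnd_pairing) e.
  by case: (enumerates _ _).
rewrite -e in h; have ex : exists t, enumerates (str (below rea_set n) t) (pairing n y).
  by exists t.
case: (ex_minnP ex) => q hq mn; exists 0; apply/hf; exists q.
rewrite !(pfst_pairing, psnd_pairing) hq; split=> // q' lt.
rewrite !(pfst_pairing, psnd_pairing); case h': (enumerates _ _) => //.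
by have := mn _ h'; rewrite leqNgt lt.
Qed.

Theorem theorem1p2 :
  exists C : nat -> bool,
    REA_omega C /\ ~ computable_set C /\
    (forall X : nat -> bool,
        turing_le X C -> turing_le X halting_set -> computable_set X).
Proof.
exists rea_set; split; first exact: REA_rea_set.
split; first exact: noncomputable rea_setE.
by move=> X [a ha] [b hb]; apply: minimal_pair rea_setE ha hb.
Qed.
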